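(* Let $(\mathbb{Y},\mathcal{C},S^+)$ be one of the following: (a) $\mathbb{Y}=\mathbb{H}$, $\mathcal{C}$ is a hyperbolic circle of positive radius in $\mathbb{H}$, and $S^+$ is the disc bounded by $\mathcal{C}$; (b) $\mathbb{Y}$ is a hyperbolic cylinder with a cusp (the quotient of $\mathbb{H}$ by $z\mapsto z+1$), $\mathcal{C}$ is a closed horocycle $\{\mathrm{Im}\, z=Y\}$ with $Y>0$, and $S^+=\{\mathrm{Im}\, z> Y\}$ is the region containing the cusp. Then there is a positive smooth weight function $W(x)$ on $S^+$, depending only on $\mathbb{Y}$ and $\mathcal{C}$, such that for every eigenfunction $\psi$ of the Laplacian on $\mathbb{Y}$ with eigenvalue $\lambda>0$ which is in $L^2(S^+)$, \[ \int_{\mathcal{C}}\left(|\psi(s)|^{2}+\frac1\lambda|\partial_n\psi(s)|^2\right)\mathrm{d}s\ \geq\ \iint_{S^+}W(x)|\psi(x)|^2\,\mathrm{d}\mu . \]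
   Context: Here $\mathrm{d}s$ is the hyperbolic arclength measure on $\mathcal{C}$, $\mathrm{d}\mu$ is the hyperbolic area measure, $\partial_n\psi$ is the derivative of $\psi$ in the (hyperbolic) unit normal direction to $\mathcal{C}$, and the Laplacian is the positive one, $\Delta=-y^2(\partial_x^2+\partial_y^2)$ in the coordinate $z=x+iy$, with $\Delta\psi=\lambda\psi$. *)

(* Defs.v *)
From HB Require Import structures.
From mathcomp Require Import all_boot all_order all_algebra.
From mathcomp Require Import complex.
From mathcomp Require Import all_classical all_reals all_analysis.
From mathcomp Require Import ring lra.
Import Order.TTheory GRing.Theory Num.Theory.
Import numFieldNormedType.Exports.

Set Implicit Arguments.
Unset Strict Implicit.
Unset Printing Implicit Defensive.

Local Open Scope classical_set_scope.
Local Open Scope ring_scope.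

(* The point x + i y is the pair (x, y). *)
Definition upper_half_plane (R : realType) : set (R * R) :=
  [set z | 0 < z.2].

Definition e1 (R : realType) : R * R := (1, 0).
Definition e2 (R : realType) : R * R := (0, 1).

(* U is meant to be open: the partial derivatives are two-sided. *)
Fixpoint Ck_on (R : realType) (k : nat) (U : set (R * R)) (f : R * R -> R)
    : Prop :=
  (forall z, U z -> {for z, continuous f}) /\
  if k is k'.+1 then
    [/\ forall z, U z -> derivable f z (e1 R) /\ derivable f z (e2 R),
        Ck_on k' U ('D_(e1 R) f) &
        Ck_on k' U ('D_(e2 R) f)]
  else True.

Definition smooth_on (R : realType) (U : set (R * R)) (f : R * R -> R) : Prop :=
  forall k : nat, Ck_on k U f.

Definition cosqnorm (R : realType) (c : R[i]) : R :=
  complex.Re c ^+ 2 + complex.Im c ^+ 2.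

(* Library derivatives need a normed module over R as codomain, which R[i] is
   not, so complex-valued functions are differentiated componentwise. *)
Definition rpart (R : realType) (psi : R * R -> R[i]) (z : R * R) : R :=
  complex.Re (psi z).
Definition ipart (R : realType) (psi : R * R -> R[i]) (z : R * R) : R :=
  complex.Im (psi z).

Definition cderive (R : realType) (psi : R * R -> R[i]) (z v : R * R) : R[i] :=
  Complex ('D_v (rpart psi) z) ('D_v (ipart psi) z).

Definition hlaplacian (R : realType) (f : R * R -> R) (z : R * R) : R :=
  - (z.2 ^+ 2 * ('D_(e1 R) ('D_(e1 R) f) z + 'D_(e2 R) ('D_(e2 R) f) z)).

Definition chlaplacian (R : realType) (psi : R * R -> R[i]) (z : R * R)
    : R[i] :=
  Complex (hlaplacian (rpart psi) z) (hlaplacian (ipart psi) z).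

(* Classical (C^2) eigenfunctions; values off the half-plane are irrelevant. *)
Definition eigenfunction (R : realType) (lambda : R) (psi : R * R -> R[i])
    : Prop :=
  [/\ Ck_on 2 (@upper_half_plane R) (rpart psi),
      Ck_on 2 (@upper_half_plane R) (ipart psi),
      exists2 z, upper_half_plane z & psi z != 0 &
      forall z, upper_half_plane z ->
        chlaplacian psi z = real_complex R lambda * psi z].

(* f restricted to S is invariant under z |-> z + 1, i.e. it is a function on
   the image of S in the cylinder obtained by identifying z with z + 1. *)
Definition unit_periodic_on (R : realType) (T : Type) (S : set (R * R))
    (f : R * R -> T) : Prop :=
  forall z, S z -> f (z.1 + 1, z.2) = f z.

Definition eigenfunction_cylinder (R : realType) (lambda : R)
    (psi : R * R -> R[i]) : Prop :=
  unit_periodic_on (@upper_half_plane R) psi /\ eigenfunction lambda psi.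

(* dmu = dx dy / y^2 *)
Definition harea_integral (R : realType) (S : set (R * R)) (f : R * R -> R)
    : \bar R :=
  (\int[(@lebesgue_measure R \x @lebesgue_measure R)%E]_(z in S)
     (f z / z.2 ^+ 2)%:E)%E.

Definition hL2 (R : realType) (S : set (R * R)) (psi : R * R -> R[i]) : Prop :=
  (harea_integral S (fun z => cosqnorm (psi z)) < +oo)%E.

Definition velocity (R : realType) (gamma : R -> R * R) (t : R) : R * R :=
  (derive1 (fun s => (gamma s).1) t, derive1 (fun s => (gamma s).2) t).

Definition hspeed (R : realType) (gamma : R -> R * R) (t : R) : R :=
  Num.sqrt ((velocity gamma t).1 ^+ 2 + (velocity gamma t).2 ^+ 2)
    / (gamma t).2.

(* The velocity divided by its hyperbolic length and rotated by -pi/2; the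
   metric being conformal, it is normal and of hyperbolic length 1. *)
Definition hnormal (R : realType) (gamma : R -> R * R) (t : R) : R * R :=
  ((velocity gamma t).2 / hspeed gamma t,
   - ((velocity gamma t).1 / hspeed gamma t)).

(* int_C (|psi|^2 + |d_n psi|^2 / lambda) ds for the curve C traced once by
   gamma over [0, T]. *)
Definition hboundary_integral (R : realType) (gamma : R -> R * R) (T : R)
    (lambda : R) (psi : R * R -> R[i]) : \bar R :=
  (\int[@lebesgue_measure R]_(t in `[0%R, T])
     ((cosqnorm (psi (gamma t)) +
       lambda^-1 * cosqnorm (cderive psi (gamma t) (hnormal gamma t)))
      * hspeed gamma t)%:E)%E.

Definition cosh (R : realType) (x : R) : R := (expR x + expR (- x)) / 2.
Definition sinh (R : realType) (x : R) : R := (expR x - expR (- x)) / 2.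
Definition arcosh (R : realType) (u : R) : R := ln (u + Num.sqrt (u ^+ 2 - 1)).

Definition hdist (R : realType) (z w : R * R) : R :=
  arcosh (1 + ((z.1 - w.1) ^+ 2 + (z.2 - w.2) ^+ 2) / (2 * z.2 * w.2)).

Definition hdisc (R : realType) (w : R * R) (rho : R) : set (R * R) :=
  [set z | upper_half_plane z /\ hdist z w < rho].

Definition hcircle (R : realType) (w : R * R) (rho : R) : set (R * R) :=
  [set z | upper_half_plane z /\ hdist z w = rho].

(* A hyperbolic circle is a Euclidean circle with a different centre; see
   hcircle_paramE and hcircle_param_inj. *)
Definition hcircle_param (R : realType) (w : R * R) (rho : R) (t : R) : R * R :=
  (w.1 + w.2 * sinh rho * cos t, w.2 * cosh rho + w.2 * sinh rho * sin t).

Definition cusp_region (R : realType) (Y : R) : set (R * R) :=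
  [set z | Y < z.2].

(* Fundamental domain of cusp_region for z |-> z + 1. *)
Definition cusp_strip (R : realType) (Y : R) : set (R * R) :=
  [set z | 0 <= z.1 < 1 /\ Y < z.2].

(* Over [0, 1] this traces the closed horocycle Im z = Y once. *)
Definition horocycle_param (R : realType) (Y : R) (t : R) : R * R := (t, Y).

Lemma cosh2Bsinh2 (R : realType) (x : R) : cosh x ^+ 2 - sinh x ^+ 2 = 1.
Proof.
have h : expR x * expR (- x) = 1 by rewrite -expRD subrr expR0.
rewrite /cosh /sinh; move: h; set a := expR x; set b := expR (- x) => h.
by rewrite -[RHS]h; field.
Qed.

Lemma sinh_gt0 (R : realType) (x : R) : 0 < x -> 0 < sinh x.
Proof. by move=> x0; rewrite divr_gt0// subr_gt0 ltr_expR; lra. Qed.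

Lemma cosh_gt0 (R : realType) (x : R) : 0 < cosh x.
Proof. by rewrite divr_gt0// addr_gt0// expR_gt0. Qed.

Lemma arcoshK (R : realType) (x : R) : 0 <= x -> arcosh (cosh x) = x.
Proof.
rewrite le_eqVlt => /predU1P[<-|x0]; rewrite /arcosh.
  have -> : cosh (0 : R) = 1 by rewrite /cosh oppr0 expR0; lra.
  by rewrite expr1n subrr sqrtr0 addr0 ln1.
have -> : cosh x ^+ 2 - 1 = sinh x ^+ 2 by have := cosh2Bsinh2 x; lra.
rewrite sqrtr_sqr gtr0_norm ?sinh_gt0//.
have -> : cosh x + sinh x = expR x by rewrite /cosh /sinh; field.
exact: expRK.
Qed.

Lemma coshK (R : realType) (u : R) : 1 <= u -> cosh (arcosh u) = u.
Proof.
move=> u1; rewrite /cosh /arcosh; set s := Num.sqrt _.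
have s0 : 0 <= s by exact: sqrtr_ge0.
have s2 : s ^+ 2 = u ^+ 2 - 1 by rewrite sqr_sqrtr//; nra.
have us : 0 < u + s by lra.
rewrite expRN lnK ?posrE//.
have -> : (u + s)^-1 = u - s.
  by apply: (mulfI (lt0r_neq0 us)); rewrite divff ?lt0r_neq0//; nra.
by field.
Qed.

Lemma hcircle_eq (R : realType) (w z : R * R) (rho : R) :
  upper_half_plane w -> 0 < rho -> upper_half_plane z ->
  hdist z w = rho <->
  (z.1 - w.1) ^+ 2 + (z.2 - w.2 * cosh rho) ^+ 2 = (w.2 * sinh rho) ^+ 2.
Proof.
rewrite /upper_half_plane/= => w0 rho0 z0.
have d0 : 0 < 2 * z.2 * w.2 by rewrite !mulr_gt0.
have n0 : 0 <= (z.1 - w.1) ^+ 2 + (z.2 - w.2) ^+ 2.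
  by rewrite addr_ge0 ?sqr_ge0.
have cs := cosh2Bsinh2 rho.
have E : (z.1 - w.1) ^+ 2 + (z.2 - w.2 * cosh rho) ^+ 2 - (w.2 * sinh rho) ^+ 2
    = (z.1 - w.1) ^+ 2 + (z.2 - w.2) ^+ 2 - (cosh rho - 1) * (2 * z.2 * w.2).
  have -> : (w.2 * sinh rho) ^+ 2 = w.2 ^+ 2 * (cosh rho ^+ 2 - 1).
    by rewrite exprMn; congr (_ * _); lra.
  by ring.
rewrite /hdist; move: n0 d0 E; set N := (X in 0 <= X); set D := 2 * _ * _.
move=> n0 d0 E; split=> [h|/eqP].
  apply/eqP; rewrite -subr_eq0 E -h coshK; last by rewrite lerDl divr_ge0// ltW.
  by rewrite (addrC 1) addrK divfK ?subrr// lt0r_neq0.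
rewrite -subr_eq0 E subr_eq0 => /eqP ->.
by rewrite mulfK ?lt0r_neq0// addrC subrK arcoshK// ltW.
Qed.

Lemma cos_sin_surj (R : realType) (a b : R) : a ^+ 2 + b ^+ 2 = 1 ->
  exists2 t, 0 <= t < 2 * pi & cos t = a /\ sin t = b.
Proof.
move=> ab; have a1 : -1 <= a <= 1 by nra.
have pi0 := pi_gt0 R.
have ca : cos (acos a) = a by apply: acosK; rewrite in_itv.
have s2 : sin (acos a) ^+ 2 = b ^+ 2 by rewrite sin2cos2 ca; lra.
have ac0 := acos_ge0 a1; have acpi := acos_lepi a1.
have s0 : 0 <= sin (acos a) by apply: sin_ge0_pi; rewrite ac0.
have [b0|b0] := leP 0 b.
  exists (acos a); first by lra.
  by split=> //; apply/eqP; rewrite -(@eqrXn2 _ 2)// s2.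
have sb : sin (acos a) = - b.
  by apply/eqP; rewrite -(@eqrXn2 _ 2)// ?s2 ?sqrrN// oppr_ge0 ltW.
have an0 : 0 < acos a.
  rewrite lt0r ac0 andbT; apply/eqP => h; move: sb; rewrite h sin0; lra.
exists (2 * pi - acos a); first by lra.
rewrite mulr_natl; split.
  by rewrite addrC cosD2pi cosN.
by rewrite addrC sinD2pi sinN sb opprK.
Qed.

Lemma cos_sin_inj (R : realType) (s t : R) :
  0 <= s < 2 * pi -> 0 <= t < 2 * pi -> cos s = cos t -> sin s = sin t -> s = t.
Proof.
wlog st : s t / s <= t.
  by move=> H hs ht c d; have [/H|/ltW/H] := leP s t; [exact|move=> ->].
move=> hs ht cE sE; apply/eqP; rewrite eq_le st /= leNgt; apply/negP => lt_st.
have c1 : cos (t - s) = 1 by rewrite cosB cE sE -!expr2 cos2Dsin2.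
have : 0 < sin ((t - s) / 2) by apply: sin_gt0_pi; lra.
have : cos (t - s) = 1 - sin ((t - s) / 2) ^+ 2 *+ 2.
  rewrite {1}(_ : t - s = ((t - s) / 2) *+ 2); last by rewrite mulr2n; lra.
  by rewrite cos_mulr2n cos2sin2 mulr2n; lra.
rewrite c1 mulr2n; nra.
Qed.

Lemma hcircle_paramE (R : realType) (w : R * R) (rho : R) :
  upper_half_plane w -> 0 < rho ->
  hcircle_param w rho @` `[0, 2 * pi] = hcircle w rho.
Proof.
move=> w0 rho0; have w0' : 0 < w.2 := w0; have sh := sinh_gt0 rho0.
have r0 : 0 < w.2 * sinh rho by rewrite mulr_gt0.
have ch : sinh rho < cosh rho.
  by have := cosh2Bsinh2 rho; have := cosh_gt0 rho; nra.
have rc : w.2 * sinh rho < w.2 * cosh rho by rewrite ltr_pM2l.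
apply/seteqP; split=> [z [t _ <-]|z [z0 /(hcircle_eq w0 rho0 z0) h]].
  have H : upper_half_plane (hcircle_param w rho t).
    rewrite /upper_half_plane/=; have /andP[] : -1 <= sin t <= 1.
      by rewrite sin_geN1 sin_le1.
    nra.
  split=> //; apply/(hcircle_eq w0 rho0 H) => /=.
  by rewrite !(addrC _ (_ * sin t), addrC _ (_ * cos t)) !addrK
             !(exprMn _ _ (cos t), exprMn _ _ (sin t)) -mulrDr cos2Dsin2 mulr1.
have [|t tpi [ct st]] := @cos_sin_surj R ((z.1 - w.1) / (w.2 * sinh rho))
    ((z.2 - w.2 * cosh rho) / (w.2 * sinh rho)).
  by rewrite !expr_div_n -mulrDl h divff// expf_neq0// lt0r_neq0.
exists t; first by rewrite /= in_itv/=; lra.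
rewrite /hcircle_param ct st !(mulrC (w.2 * sinh rho)) !divfK ?lt0r_neq0//.
by rewrite addrC subrK addrC subrK; case: (z).
Qed.

Lemma hcircle_param_inj (R : realType) (w : R * R) (rho s t : R) :
  upper_half_plane w -> 0 < rho -> 0 <= s < 2 * pi -> 0 <= t < 2 * pi ->
  hcircle_param w rho s = hcircle_param w rho t -> s = t.
Proof.
move=> w0 rho0 hs ht [] /addrI c /addrI d.
have r0 : w.2 * sinh rho != 0 by rewrite mulf_neq0 ?lt0r_neq0 ?sinh_gt0.
by apply: cos_sin_inj => //; apply: (mulfI r0).
Qed.

(* Main.v *)
(* Rellich's identity.  Let X be a conformal vector field and write the equation
   as psi_xx + psi_yy = - lambda psi / y^2.  For real psi, the field
     F = 2 (X psi) grad psi - |grad psi|^2 X + lambda psi^2 y^-2 X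
   has divergence lambda psi^2 div (y^-2 X), because the Dirichlet integral is
   conformally invariant in dimension two.  If X is an outward normal field along
   C, then the flux of F through C is at most a multiple of the left-hand side:
   the tangential derivative enters with a negative sign.
   For the circle, X is the hyperbolic dilation field about the centre, and
   div (y^-2 X) is bounded below by a multiple of y^-2.  For the horocycle,
   X = - d/dy and div (y^-2 X) = 2 y^-3; there the flux G(y) through Im z = y is
   nonincreasing, and it stays nonnegative, since otherwise the convexity of
   m(y) = int |psi|^2 dx would force m to grow quadratically, against
   psi in L^2. *)

(* Origin of the weights: on the disc let b be the height of the hyperbolic centre and r = b sinh
   rho the Euclidean radius. The divergence is at least 4 lambda b |psi|^2 / y^2, because y^2 + b^2
   >= 2 b y, and the flux is at most 2 lambda r times the boundary integral; hence W = 2 b / r = 2 /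
   sinh rho. In the cusp the same quotient is 2 Y / y; it is lowered to 2 Y exp(- y), whose partial
   derivatives of all orders stay in one simple family. Lambda cancels because divergence and flux
   carry it to the same power. Obstacles: psi is only C^2, so F is only C^1 and the cancellation in
   its divergence rests on the equality of the mixed second derivatives. In the cusp nothing is
   assumed about the size of grad psi, so every identity is proved on truncated strips, and only the
   integral of W |psi|^2 passes to the limit. A complex psi enters through its real and imaginary
   parts, whose fields F are added. *)
Require Import Defs.
From HB Require Import structures.
From mathcomp Require Import all_boot all_order all_algebra.
From mathcomp Require Import complex.
From mathcomp Require Import all_classical all_reals all_analysis.
From mathcomp Require Import measurable_realfun.
From mathcomp Require Import ring lra.
Import Order.TTheory GRing.Theory Num.Theory.
Import numFieldNormedType.Exports.
Set Implicit Arguments.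
Unset Strict Implicit.
Unset Printing Implicit Defensive.
Local Open Scope classical_set_scope.
Local Open Scope ring_scope.

(** * Measurability and extension of functions on the plane *)

Section plane_measure.
Context {R : realType}.
Local Notation mu := (@lebesgue_measure R).
Local Notation mu2 := (@lebesgue_measure R \x @lebesgue_measure R)%E.
Local Notation R2 := (measurableTypeR R * measurableTypeR R)%type.
Implicit Types (f g : R * R -> R) (D : set (R * R)).

Let rat_box (q : rat * rat * rat * rat) : set (R * R) :=
  [set z | ratr q.1.1.1 < z.1 < ratr q.1.1.2 /\ ratr q.1.2 < z.2 < ratr q.2].

Let rat_boxE q : rat_box q =
  `]ratr q.1.1.1, ratr q.1.1.2[ `*` `]ratr q.1.2, ratr q.2[.
Proof. by apply/seteqP; split=> z [h k]; split; move: h k; rewrite /= !in_itv. Qed.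

(** Measurability refers to the product sigma-algebra, which contains every box; an open set is the
    union of the countably many rational boxes inside it. *)
Lemma open_measurable2 D : open D -> measurable (D : set R2).
Proof.
move=> oD.
(* Boxes not contained in [D] are replaced by the empty set, so that the union runs over a whole
   countable type. *)
have -> : D = \bigcup_q (if `[< rat_box q `<=` D >] then rat_box q else set0).
  apply/seteqP; split=> [[x y] Dz|z [q _]]; last first.
    by case: asboolP => // qD /qD.
  have [e /= e0 eD] : nbhs_ball (x, y) D.
    by apply/nbhs_ballP; exact: open_nbhs_nbhs.
  have [|q1 /[!in_itv]/= ?] := @rat_in_itvoo R (x - e) x; first lra.
  have [|q2 /[!in_itv]/= ?] := @rat_in_itvoo R x (x + e); first lra.
  have [|q3 /[!in_itv]/= ?] := @rat_in_itvoo R (y - e) y; first lra.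
  have [|q4 /[!in_itv]/= ?] := @rat_in_itvoo R y (y + e); first lra.
  exists (q1, q2, q3, q4) => //; rewrite asboolT => /= [|[a b] /= [/= h h']].
    by split => /=; lra.
  by apply: eD; split; rewrite /ball/= ltr_norml; lra.
apply: (@countable_bigcupT_measurable _ _ (rat * rat * rat * rat)%type) => [|q].
  exact: countableP.
case: asboolP => // _; rewrite rat_boxE; exact: measurableX.
Qed.

Lemma open_continuous_measurable_fun2 (U : set (R * R)) f :
  open U -> (forall z, U z -> {for z, continuous f}) ->
  measurable_fun (U : set R2) f.
Proof.
move=> oU cf; apply: (measurability _ (RGenOpens.measurableE R)).
move=> _ [_ [a [b ->] <-]]; apply: (@open_measurable2 (U `&` f @^-1` `]a, b[)).
rewrite openE => z [Uz /= fz].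
have fz' := cf _ Uz; apply: filterI; first exact: open_nbhs_nbhs.
by apply: fz'; apply: open_nbhs_nbhs; split => //; exact: interval_open.
Qed.

Lemma continuous_measurable_fun2 f D :
  measurable (D : set R2) -> continuous f -> measurable_fun (D : set R2) f.
Proof.
move=> mD cf.
have h := open_continuous_measurable_fun2 openT (fun z _ => cf z).
exact: measurable_funS h.
Qed.

End plane_measure.

Lemma continuous_pair (T U V : topologicalType) (f : T -> U) (g : T -> V) x :
  {for x, continuous f} -> {for x, continuous g} ->
  {for x, continuous (fun t => (f t, g t))}.
Proof. by move=> cf cg; apply: (cvg_pair cf cg). Qed.

Section clamp.
Context {R : realType}.

(** The retraction of the line onto the segment from [a] to [b]; used in both coordinates it
    retracts the plane onto a box. *)
Definition clamp (a b x : R) : R := Num.max a (Num.min x b).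

Lemma clamp_continuous a b : continuous (clamp a b).
Proof.
move=> x; apply: (@continuous_max _ _ (cst a) (id \min cst b) x).
  exact: cvg_cst.
by apply: (@continuous_min _ _ id (cst b) x); [exact: cvg_id|exact: cvg_cst].
Qed.

Lemma clamp_itv a b x : a <= b -> a <= clamp a b x <= b.
Proof.
by move=> ab; rewrite /clamp le_max lexx/= ge_max ab/= ge_min lexx orbT.
Qed.

Lemma clampK a b x : a <= x <= b -> clamp a b x = x.
Proof. by move=> /andP[ax xb]; rewrite /clamp (min_idPl xb) (max_idPr ax). Qed.

End clamp.

Section box.
Context {R : realType}.

Definition box (a b c d : R) : set (R * R) :=
  [set z | a <= z.1 <= b /\ c <= z.2 <= d].

(* Every function continuous at the points of a box agrees there with a
   globally continuous one, which spares all one-sided continuity at edges. *)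
Lemma box_extension (a b c d : R) (f : R * R -> R) : a <= b -> c <= d ->
  (forall z, box a b c d z -> {for z, continuous f}) ->
  exists g, [/\ continuous g, forall z, box a b c d z -> g z = f z &
                exists M, forall z, `|g z| <= M].
Proof.
move=> ab cd cf; pose k (z : R * R) := (clamp a b z.1, clamp c d z.2).
have kbox z : box a b c d (k z) by split; exact: clamp_itv.
have ck : continuous k.
  have c1 : continuous (clamp a b \o @fst R R).
    by move=> z; apply: continuous_comp; [exact: cvg_fst|exact: clamp_continuous].
  have c2 : continuous (clamp c d \o @snd R R).
    by move=> z; apply: continuous_comp; [exact: cvg_snd|exact: clamp_continuous].
  by move=> z; exact: (continuous_pair (c1 z) (c2 z)).
have cfk : continuous (f \o k).
  by move=> z; apply: continuous_comp; [exact: ck|exact: cf].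
exists (f \o k); split => //.
  by move=> [x y] [h1 h2]; rewrite /k /= !clampK.
have cB : compact (`[a, b] `*` `[c, d]).
  by apply: compact_setX; exact: segment_compact.
have cn : continuous (fun z => `|(f \o k) z|).
  by move=> z; apply: continuous_comp; [exact: cfk|exact: norm_continuous].
have [||z0 _ z0P] := @compact_EVT_max _ _ (fun z => `|(f \o k) z|) _ _ cB.
- by exists (a, c); split; rewrite /= in_itv/= ?lexx ?ab ?cd.
- exact: continuous_subspaceT.
exists (`|(f \o k) z0|) => z /=.
(* The retraction is idempotent, so every value of [f \o k] is already taken in the box, where the
   maximum bounds it. *)
have -> : k z = k (k z).
  by have [h1 h2] := kbox z; rewrite {2}/k !clampK//; case: (k z).
by apply: z0P; rewrite inE; have [] := kbox z; split; rewrite /= in_itv.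
Qed.

End box.

(** * Fubini and the fundamental theorem of calculus on planar regions *)

Section box_fubini.
Context {R : realType}.
Local Notation mu := (@lebesgue_measure R).
Local Notation mu2 := (@lebesgue_measure R \x @lebesgue_measure R)%E.
Local Notation R2 := (measurableTypeR R * measurableTypeR R)%type.
Variables (a b c d : R) (D : set (R * R)) (f : R * R -> R).
Hypotheses (ab : a <= b) (cd : c <= d).
Hypotheses (mD : measurable (D : set R2)) (DB : D `<=` box a b c d).
Hypothesis cf : forall z, box a b c d z -> {for z, continuous f}.

Let segment_fin (s t : R) : (mu `[s, t] < +oo)%E.
Proof.
by rewrite lebesgue_measure_itv/=; case: ifP => _; rewrite ?ltry// -EFinB ltry.
Qed.

(** [D] has finite measure, and on it [f] agrees with a bounded continuous extension, for which
    measurability and boundedness hold globally. *)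
Lemma box_integrable : mu2.-integrable D (EFin \o f).
Proof.
have [g [cg gf [M gM]]] := box_extension ab cd cf.
apply: (@eq_integrable _ _ _ _ _ mD (EFin \o g) (EFin \o f)).
  by move=> z /[1!inE] Dz /=; rewrite gf//; exact: DB.
apply: measurable_bounded_integrable => //.
- have boxE : box a b c d = `[a, b] `*` `[c, d].
    by apply/seteqP; split=> z [h k]; split; move: h k; rewrite /= !in_itv.
  have mB : measurable (box a b c d : set R2) by rewrite boxE; exact: measurableX.
  apply: (@le_lt_trans _ _ (mu2 (box a b c d))).
    by apply: le_measure => //; rewrite inE.
  rewrite boxE product_measure1E// lte_mul_pinfty// ?ge0_fin_numE//;
    exact: segment_fin.
- exact: continuous_measurable_fun2.
- exists M; split; first exact: num_real; move=> N MN z _ /=;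
    exact: le_trans (gM z) (ltW MN).
Qed.

Let integrable_restr : mu2.-integrable setT ((EFin \o f) \_ D).
Proof. by apply/integrable_restrict => //; rewrite setTI; exact: box_integrable. Qed.

Let section_integrable (E : set (measurableTypeR R)) (h : R -> R) (s t : R) (g : R -> R) :
  measurable E -> E `<=` `[s, t] -> continuous g -> (forall x, E x -> g x = h x) ->
  (exists M, forall x, `|g x| <= M) -> mu.-integrable E (EFin \o h).
Proof.
move=> mE Est cg gh [M gM].
apply: (@eq_integrable _ _ _ _ _ mE (EFin \o g)).
  by move=> z /[1!inE] Dz /=; rewrite gh.
apply: measurable_bounded_integrable => //.
- apply: (@le_lt_trans _ _ (mu `[s, t])); last exact: segment_fin.
  by apply: le_measure => //; rewrite inE.
- apply: (@measurable_funS _ _ _ _ setT) => //; exact: continuous_measurable_fun.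
- by exists M; split; first exact: num_real; move=> N MN z _ /=;
    exact: le_trans (gM z) (ltW MN).
Qed.

Lemma xsection_integrable x :
  mu.-integrable (xsection D x) (EFin \o (fun y => f (x, y))).
Proof.
have [g [cg gf [M gM]]] := box_extension ab cd cf.
apply: (@section_integrable _ _ c d (fun y => g (x, y))).
- exact: measurable_xsection.
- by move=> y; rewrite /xsection/= inE => /DB[/= _]; rewrite in_itv.
- move=> y; apply: (@continuous_comp _ _ _ (fun y => (x, y)) g); last exact: cg.
  by apply: continuous_pair; [exact: cvg_cst|exact: cvg_id].
- by move=> y; rewrite /xsection/= inE => /DB h; exact: gf.
- by exists M.
Qed.

Lemma ysection_integrable y :
  mu.-integrable (ysection D y) (EFin \o (fun x => f (x, y))).
Proof.
have [g [cg gf [M gM]]] := box_extension ab cd cf.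
apply: (@section_integrable _ _ a b (fun x => g (x, y))).
- exact: measurable_ysection.
- by move=> x; rewrite /ysection/= inE => /DB[/= + _]; rewrite in_itv.
- move=> x; apply: (@continuous_comp _ _ _ (fun x => (x, y)) g); last exact: cg.
  by apply: continuous_pair; [exact: cvg_id|exact: cvg_cst].
- by move=> x; rewrite /ysection/= inE => /DB h; exact: gf.
- by exists M.
Qed.

Let F x := \int[mu]_(y in xsection D x) f (x, y).
Let G y := \int[mu]_(x in ysection D y) f (x, y).

Let FE x : (F x)%:E = fubini_F mu ((EFin \o f) \_ D) x.
Proof.
rewrite /F /Rintegral fineK; last first.
  by apply: integrable_fin_num (xsection_integrable x); exact: measurable_xsection.
rewrite integral_mkcond; apply: eq_integral => y _.
by rewrite !patchE mem_xsection.
Qed.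

Let GE y : (G y)%:E = fubini_G mu ((EFin \o f) \_ D) y.
Proof.
rewrite /G /Rintegral fineK; last first.
  by apply: integrable_fin_num (ysection_integrable y); exact: measurable_ysection.
rewrite integral_mkcond; apply: eq_integral => x _.
by rewrite !patchE mem_ysection.
Qed.

Lemma box_fubini1 : mu.-integrable `[a, b] (EFin \o F) /\
  \int[mu2]_(z in D) f z = \int[mu]_(x in `[a, b]) F x.
Proof.
have iF : mu.-integrable setT (EFin \o F).
  apply: eq_integrable (integrable_fubini_F integrable_restr) => //.
  by move=> x _ /=; rewrite FE.
split; first by apply: integrableS iF.
rewrite [RHS]Rintegral_mkcond /Rintegral; congr fine.
rewrite [LHS]integral_mkcond -(integral12_prod_meas1 integrable_restr).
apply: eq_integral => x _; transitivity (F x)%:E; first by rewrite FE.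
rewrite patchE; case: ifPn => // /negP xab.
congr EFin; rewrite /F (_ : xsection _ _ = set0) ?Rintegral_set0//.
apply/seteqP; split=> // y; rewrite /xsection/= inE => /DB[/= h _].
by apply: xab; rewrite inE /= in_itv.
Qed.

Lemma box_fubini2 : mu.-integrable `[c, d] (EFin \o G) /\
  \int[mu2]_(z in D) f z = \int[mu]_(y in `[c, d]) G y.
Proof.
have iG : mu.-integrable setT (EFin \o G).
  have mf := measurable_int _ integrable_restr.
  have mG : measurable_fun [set: measurableTypeR R] (fubini_G mu ((EFin \o f) \_ D)).
    exact: measurable_fubini_G integrable_restr.
  have -> : EFin \o G = fubini_G mu ((EFin \o f) \_ D).
    by apply/funext => y /=; rewrite GE.
  apply/integrableP; split => //.
  (* Integrability of [G]: its modulus is at most the inner integral of the modulus, which Tonelli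
     shows to have a finite outer integral. *)
  have [+ _] := integrable21ltyP mu mu mf.
  move=> /(_ integrable_restr); apply: le_lt_trans.
  apply: ge0_le_integral => //.
  - exact: measurableT_comp.
  - have mh : measurable_fun [set: R2] (abse \o ((EFin \o f) \_ D)).
      exact: measurableT_comp.
    by have := measurable_fun_fubini_tonelli_G (m1 := mu) _ mh (fun=> abse_ge0 _).
  - move=> y _; apply: le_abse_integral => //.
    by apply: measurableT_comp => //; exact: pair2_measurable.
split; first by apply: integrableS iG.
rewrite [RHS]Rintegral_mkcond /Rintegral; congr fine.
rewrite [LHS]integral_mkcond -(integral21_prod_meas1 integrable_restr).
apply: eq_integral => y _; transitivity (G y)%:E; first by rewrite GE.
rewrite patchE; case: ifPn => // /negP xab.
congr EFin; rewrite /G (_ : ysection _ _ = set0) ?Rintegral_set0//.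
apply/seteqP; split=> // x; rewrite /ysection/= inE => /DB[/= _ h].
by apply: xab; rewrite inE /= in_itv.
Qed.

End box_fubini.

Section one_variable.
Context {R : realType}.
Local Notation mu := (@lebesgue_measure R).
Implicit Types (f g F : R -> R).

Lemma continuous_segment_integrable f (a b : R) :
  (forall x, a <= x <= b -> {for x, continuous f}) ->
  mu.-integrable `[a, b] (EFin \o f).
Proof.
move=> cf; apply: continuous_compact_integrable; first exact: segment_compact.
apply: continuous_in_subspaceT => x /[1!inE] /=; rewrite in_itv; exact: cf.
Qed.

(** Endpoints are null sets. The flags [s] and [t] cover at once the open chords of a disc and the
    half-open period of a strip. *)
Lemma Rintegral_bndbnd f (a b : R) (s t : bool) :
  (forall x, a <= x <= b -> {for x, continuous f}) ->
  \int[mu]_(x in [set` Interval (BSide s a) (BSide t b)]) f x =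
  \int[mu]_(x in `[a, b]) f x.
Proof.
move=> cf; have /integrableP[mf _] := continuous_segment_integrable cf.
have mf' : measurable_fun `]a, b[ (EFin \o f).
  by apply: measurable_funS mf => //; exact: subset_itv_oo_cc.
by rewrite /Rintegral (integral_itv_bndoo true false mf') (integral_itv_bndoo s t mf').
Qed.

Lemma FTC_segment f F (a b : R) : a <= b ->
  (forall x, a <= x <= b -> {for x, continuous f}) ->
  (forall x, a <= x <= b -> is_derive x 1 F (f x)) ->
  \int[mu]_(x in `[a, b]) f x = F b - F a.
Proof.
rewrite le_eqVlt => /predU1P[<- _ _|ab cf dF].
  by rewrite set_itv1 Rintegral_set1 subrr.
have cF x : a <= x <= b -> {for x, continuous F}.
  by move=> /dF[h _]; exact/differentiable_continuous/derivable1_diffP.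
rewrite /Rintegral (@continuous_FTC2 _ _ F)//.
- apply: continuous_in_subspaceT => x /[1!inE] /=; rewrite in_itv; exact: cf.
- split.
  + move=> x; rewrite in_itv => /andP[? ?].
    by have [] : is_derive x 1 F (f x) by apply: dF; rewrite !ltW.
  + by apply: cvg_at_right_filter; apply: cF; rewrite lexx ltW.
  + by apply: cvg_at_left_filter; apply: cF; rewrite lexx ltW.
- move=> x; rewrite in_itv => /andP[? ?]; rewrite derive1E.
  by have /dF/@derive_val : a <= x <= b by rewrite !ltW.
Qed.

(** Derivatives are two-sided, so the base point [a] itself is excluded; callers start one unit
    before the interval that they need. *)
Lemma antiderivative f (a : R) : continuous f ->
  exists F, forall x, a < x -> is_derive x 1 F (f x).
Proof.
move=> cf; exists (fun x => \int[mu]_(t in `[a, x]) f t) => x ax.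
have h : mu.-integrable `[a, x + 1] (EFin \o f).
  by apply: continuous_segment_integrable => t _; exact: cf.
have xx1 : x < x + 1 by lra.
have [dF F'] := continuous_FTC1_closed xx1 h ax (cf x).
by apply: DeriveDef; [exact: dF|rewrite -derive1E].
Qed.

End one_variable.

Section partial_sections.
Context {R : realType}.

Lemma is_derive_e1P (F : R * R -> R) (x y v : R) :
  is_derive (x, y) (e1 R) F v <-> is_derive x 1 (fun t => F (t, y)) v.
Proof.
have E : (fun h : R => h^-1 *: (F (h *: e1 R + (x, y)) - F (x, y))) =
         (fun h : R => h^-1 *: (F (h *: 1 + x, y) - F (x, y))).
  apply/funext => h; congr (_ *: (F _ - _)).
  by congr pair; rewrite /= [_ *: 0]mulr0 add0r.
by split=> -[dF F']; apply: DeriveDef; move: dF F'; rewrite /derivable /derive E.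
Qed.

Lemma is_derive_e2P (F : R * R -> R) (x y v : R) :
  is_derive (x, y) (e2 R) F v <-> is_derive y 1 (fun t => F (x, t)) v.
Proof.
have E : (fun h : R => h^-1 *: (F (h *: e2 R + (x, y)) - F (x, y))) =
         (fun h : R => h^-1 *: (F (x, h *: 1 + y) - F (x, y))).
  apply/funext => h; congr (_ *: (F _ - _)).
  by congr pair; rewrite /= [_ *: 0]mulr0 add0r.
by split=> -[dF F']; apply: DeriveDef; move: dF F'; rewrite /derivable /derive E.
Qed.

Lemma continuous_section1 (F : R * R -> R) (x y : R) :
  {for (x, y), continuous F} -> {for x, continuous (fun t => F (t, y))}.
Proof.
move=> cF; apply: (@continuous_comp _ _ _ (fun t => (t, y)) F) => //.
by apply: continuous_pair; [exact: cvg_id|exact: cvg_cst].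
Qed.

Lemma continuous_section2 (F : R * R -> R) (x y : R) :
  {for (x, y), continuous F} -> {for y, continuous (fun t => F (x, t))}.
Proof.
move=> cF; apply: (@continuous_comp _ _ _ (fun t => (x, t)) F) => //.
by apply: continuous_pair; [exact: cvg_cst|exact: cvg_id].
Qed.

End partial_sections.

Section green.
Context {R : realType}.
Local Notation mu := (@lebesgue_measure R).
Local Notation mu2 := (@lebesgue_measure R \x @lebesgue_measure R)%E.
Local Notation R2 := (measurableTypeR R * measurableTypeR R)%type.
Variables (a b c d : R) (D : set (R * R)) (F f : R * R -> R).
Hypotheses (ab : a <= b) (cd : c <= d).
Hypotheses (mD : measurable (D : set R2)) (DB : D `<=` box a b c d).
Hypothesis cf : forall z, box a b c d z -> {for z, continuous f}.
Variables (lo hi H : R -> R) (s t s' t' : bool).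
Hypothesis cH : continuous H.

Let Rintegral_bndbnd_integrable (g : R -> R) (u v : R) (i j : bool) :
  mu.-integrable `[u, v] (EFin \o g) ->
  \int[mu]_(x in `[u, v]) g x =
  \int[mu]_(x in [set` Interval (BSide i u) (BSide j v)]) g x.
Proof.
move=> /integrableP[mg _].
have mg' : measurable_fun `]u, v[ (EFin \o g).
  by apply: measurable_funS mg => //; exact: subset_itv_oo_cc.
by rewrite /Rintegral (integral_itv_bndoo true false mg') (integral_itv_bndoo i j mg').
Qed.

(** Fubini, then the fundamental theorem on each vertical section. The sections need only be
    described up to the ends of the base, since for instance the half-open strip has an empty
    section at its right end; the continuous [H] lets the base be closed again. *)
Lemma green_xsection :
  (forall z, box a b c d z -> is_derive z (e2 R) F (f z)) ->
  (forall x, x \in Interval (BSide s a) (BSide t b) ->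
    [/\ xsection D x = [set` Interval (BSide s' (lo x)) (BSide t' (hi x))],
        c <= lo x, lo x <= hi x, hi x <= d & F (x, hi x) - F (x, lo x) = H x]) ->
  \int[mu2]_(z in D) f z = \int[mu]_(x in `[a, b]) H x.
Proof.
move=> dF DE; have [iG ->] := box_fubini1 ab cd mD DB cf.
rewrite (Rintegral_bndbnd_integrable s t iG).
rewrite -(@Rintegral_bndbnd _ H a b s t) => [|x _]; last exact: cH.
apply: eq_Rintegral => x; rewrite inE /= => xab.
have [-> clo lohi hid <-] := DE _ xab.
have axb : a <= x <= b.
  move: xab; case: (s); case: (t); rewrite in_itv /= => /andP[h1 h2];
    by rewrite ?h1 ?h2 ?(ltW h1) ?(ltW h2).
have B y : lo x <= y <= hi x -> box a b c d (x, y).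
  by move=> /andP[h1 h2]; split => //=; rewrite (le_trans clo h1) (le_trans h2 hid).
rewrite Rintegral_bndbnd => [|y /B/cf]; last exact: continuous_section2.
apply: (FTC_segment (F := fun y => F (x, y))) => // y /B.
  by move=> /cf; exact: continuous_section2.
by move=> /dF /is_derive_e2P.
Qed.

Lemma green_ysection :
  (forall z, box a b c d z -> is_derive z (e1 R) F (f z)) ->
  (forall y, y \in Interval (BSide s c) (BSide t d) ->
    [/\ ysection D y = [set` Interval (BSide s' (lo y)) (BSide t' (hi y))],
        a <= lo y, lo y <= hi y, hi y <= b & F (hi y, y) - F (lo y, y) = H y]) ->
  \int[mu2]_(z in D) f z = \int[mu]_(y in `[c, d]) H y.
Proof.
move=> dF DE; have [iG ->] := box_fubini2 ab cd mD DB cf.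
rewrite (Rintegral_bndbnd_integrable s t iG).
rewrite -(@Rintegral_bndbnd _ H c d s t) => [|x _]; last exact: cH.
apply: eq_Rintegral => y; rewrite inE /= => ycd.
have [-> alo lohi hib <-] := DE _ ycd.
have cyd : c <= y <= d.
  move: ycd; case: (s); case: (t); rewrite in_itv /= => /andP[h1 h2];
    by rewrite ?h1 ?h2 ?(ltW h1) ?(ltW h2).
have B x : lo y <= x <= hi y -> box a b c d (x, y).
  by move=> /andP[h1 h2]; split => //=; rewrite (le_trans alo h1) (le_trans h2 hib).
rewrite Rintegral_bndbnd => [|x /B/cf]; last exact: continuous_section1.
apply: (FTC_segment (F := fun x => F (x, y))) => // x /B.
  by move=> /cf; exact: continuous_section1.
by move=> /dF /is_derive_e1P.
Qed.

End green.

(** * The divergence theorem on a Euclidean disc *)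

Section circle.
Context {R : realType}.
Local Notation mu := (@lebesgue_measure R).
Local Notation mu2 := (@lebesgue_measure R \x @lebesgue_measure R)%E.
Local Notation R2 := (measurableTypeR R * measurableTypeR R)%type.

Lemma Rintegral_substitution (f F u du : R -> R) (a b : R) : a <= b ->
  (forall t, a <= t <= b -> is_derive t 1 u (du t)) ->
  (forall t, a <= t <= b -> is_derive (u t) 1 F (f (u t))) ->
  (forall t, a <= t <= b -> {for t, continuous (fun t => f (u t) * du t)}) ->
  \int[mu]_(t in `[a, b]) (f (u t) * du t) = F (u b) - F (u a).
Proof.
move=> ab du' dF cf; apply: (FTC_segment (F := F \o u) ab cf) => t tab.
by apply: is_derive1_comp; [exact: dF|exact: du'].
Qed.

Lemma Rintegral_itv_cat (f : R -> R) (a b c : R) : continuous f ->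
  a <= b -> b <= c ->
  \int[mu]_(t in `[a, c]) f t =
  \int[mu]_(t in `[a, b]) f t + \int[mu]_(t in `[b, c]) f t.
Proof.
move=> cf ab bc; have [F dF] := antiderivative (a - 1) cf.
have dF' x : a <= x -> is_derive x 1 F (f x) by move=> ax; apply: dF; lra.
have FTC s t : a <= s -> s <= t -> \int[mu]_(x in `[s, t]) f x = F t - F s.
  move=> sa st; apply: FTC_segment => // x /andP[sx _]; first exact: cf.
  by apply: dF'; exact: le_trans sx.
by rewrite !FTC//; [ring|exact: le_trans bc].
Qed.

Section circle_integrals.
Variables (c1 c2 r : R).
Hypothesis r0 : 0 < r.

Definition circle (t : R) : R * R := (c1 + r * cos t, c2 + r * sin t).

Definition disc : set (R * R) :=
  [set z | (z.1 - c1) ^+ 2 + (z.2 - c2) ^+ 2 < r ^+ 2].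

(** Half the length of the chord at coordinate [u]. It is continuous on the whole line because the
    square root of a negative number is 0. *)
Definition chord (c u : R) : R := Num.sqrt (r ^+ 2 - (u - c) ^+ 2).

Lemma chord_continuous c : continuous (chord c).
Proof.
move=> u; apply: (@continuous_comp _ _ _ (fun u => r ^+ 2 - (u - c) ^+ 2)); last first.
  exact: sqrt_continuous.
apply: cvgB; first exact: cvg_cst.
by rewrite expr2; under eq_fun do rewrite expr2; apply: cvgM; apply: cvgB;
  [exact: cvg_id|exact: cvg_cst|exact: cvg_id|exact: cvg_cst].
Qed.

Lemma circle_continuous : continuous circle.
Proof.
move=> t; apply: (@continuous_pair _ _ _ (fun t => c1 + r * cos t)
  (fun t => c2 + r * sin t)); apply: cvgD; try exact: cvg_cst.
  by apply: cvgM; [exact: cvg_cst|exact: continuous_cos].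
by apply: cvgM; [exact: cvg_cst|exact: continuous_sin].
Qed.

Lemma chord_sin t : chord c2 (c2 + r * sin t) = r * `|cos t|.
Proof.
rewrite /chord (_ : _ - _ = (r * cos t) ^+ 2); last first.
  by rewrite (exprMn _ r) cos2sin2; ring.
by rewrite sqrtr_sqr normrM gtr0_norm.
Qed.

Lemma chord_cos t : chord c1 (c1 + r * cos t) = r * `|sin t|.
Proof.
rewrite /chord (_ : _ - _ = (r * sin t) ^+ 2); last first.
  by rewrite (exprMn _ r) sin2cos2; ring.
by rewrite sqrtr_sqr normrM gtr0_norm.
Qed.

Let dsin (t : R) : is_derive t 1 (fun t : R => c2 + r * sin t) (r * cos t).
Proof.
by apply: is_derive_eq; rewrite /GRing.scale/=; ring.
Qed.

Let dcos (t : R) : is_derive t 1 (fun t : R => c1 + r * cos t) (- (r * sin t)).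
Proof.
by apply: is_derive_eq; rewrite /GRing.scale/=; ring.
Qed.

(** Substitute [u = c2 + r * sin t]. Where the cosine is nonnegative the circle is the right arc,
    elsewhere the left one, so the period is cut at pi / 2 and 3 pi / 2. *)
Lemma circle_integral_cos (H : R * R -> R) : continuous H ->
  \int[mu]_(u in `[c2 - r, c2 + r])
    (H (c1 + chord c2 u, u) - H (c1 - chord c2 u, u)) =
  \int[mu]_(t in `[0, 2 * pi]) (H (circle t) * (r * cos t)).
Proof.
move=> cH; have pi0 := pi_gt0 R; have rp := r0.
have cr : c2 - r <= c2 + r by lra.
(* [H] along the right arc for [e = 1] and along the left arc for [e = -1]; in [piece], the
   condition on [e] selects the arc that is traced. *)
pose k (e u : R) := H (c1 + e * chord c2 u, u).
have ck e : continuous (k e).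
  move=> u; apply: (@continuous_comp _ _ _ (fun u => (c1 + e * chord c2 u, u)) H);
    last exact: cH.
  apply: continuous_pair; last exact: cvg_id.
  apply: cvgD; first exact: cvg_cst.
  by apply: cvgM; [exact: cvg_cst|exact: chord_continuous].
have [K1 dK1] := antiderivative (c2 - r - 1) (ck 1).
have [K2 dK2] := antiderivative (c2 - r - 1) (ck (-1)).
have cint : continuous (fun t => H (circle t) * (r * cos t)).
  move=> t; apply: cvgM.
    by apply: continuous_comp; [exact: circle_continuous|exact: cH].
  by apply: cvgM; [exact: cvg_cst|exact: continuous_cos].
have piece e K : (forall x, c2 - r - 1 < x -> is_derive x 1 K (k e x)) ->
    forall a b, a <= b -> (forall t, a <= t <= b -> e * `|cos t| = cos t) ->
    \int[mu]_(t in `[a, b]) (H (circle t) * (r * cos t)) =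
    K (c2 + r * sin b) - K (c2 + r * sin a).
  move=> dK a b ab sg.
  have E t : a <= t <= b ->
      k e (c2 + r * sin t) * (r * cos t) = H (circle t) * (r * cos t).
    by move=> /sg tE; rewrite /k chord_sin (mulrCA e) tE.
  transitivity (\int[mu]_(t in `[a, b]) (k e (c2 + r * sin t) * (r * cos t))).
    by apply: eq_Rintegral => t; rewrite inE/= in_itv/= => /E.
  apply: (@Rintegral_substitution (k e) K (fun t => c2 + r * sin t)
    (fun t => r * cos t)) => //.
  - move=> t _; apply: dK => /=.
    have : 0 <= r * (sin t + 1) by apply: mulr_ge0; [exact: ltW|have := sin_geN1 t; lra].
    by rewrite mulrDr; lra.
  - move=> t _; apply: cvgM.
      apply: (@continuous_comp _ _ _ (fun t => c2 + r * sin t)); last exact: ck.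
      apply: cvgD; first exact: cvg_cst.
      by apply: cvgM; [exact: cvg_cst|exact: continuous_sin].
    by apply: cvgM; [exact: cvg_cst|exact: continuous_cos].
rewrite (Rintegral_itv_cat (b := pi / 2) cint); [|lra|lra].
rewrite (Rintegral_itv_cat (a := pi / 2) (b := pi + pi / 2) cint); [|lra|lra].
rewrite (piece 1 K1)//; [|lra|]; last first.
  move=> t /andP[t0 t1]; rewrite mul1r ger0_norm// cos_ge0_pihalf//; lra.
rewrite (piece (-1) K2)//; [|lra|]; last first.
  move=> t /andP[t0 t1]; rewrite -{2}(subrK pi t) cosDpi mulN1r; congr (- _).
  rewrite -(subrK pi t) cosDpi normrN ger0_norm// ?addrK// cos_ge0_pihalf//; lra.
rewrite (piece 1 K1)//; [|lra|]; last first.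
  move=> t /andP[t0 t1]; rewrite mul1r ger0_norm//.
  have -> : cos t = cos (t - pi *+ 2) by rewrite -[in LHS](subrK (pi *+ 2) t) cosD2pi.
  by apply: cos_ge0_pihalf; rewrite (mulr2n pi); lra.
have -> : 2 * pi = 0 + pi *+ 2 :> R by rewrite (mulr2n pi); lra.
rewrite sinD2pi sin0 (addrC pi) sinDpi sin_pihalf mulr0 addr0 mulr1 mulrN1.
(* The first and the last piece both run along the right arc, and their values [K1 c2] at the angles
   0 and 2 pi cancel. *)
transitivity ((K1 (c2 + r) - K2 (c2 + r)) - (K1 (c2 - r) - K2 (c2 - r))); last by ring.
have kE u : k 1 u - k (-1) u = H (c1 + chord c2 u, u) - H (c1 - chord c2 u, u).
  by rewrite /k mul1r mulN1r.
transitivity (\int[mu]_(u in `[c2 - r, c2 + r]) (k 1 u - k (-1) u)).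
  by apply: eq_Rintegral => u _; rewrite kE.
apply: (FTC_segment (F := fun u => K1 u - K2 u) cr).
  by move=> u _; apply: cvgB; exact: ck.
by move=> u /andP[u1 u2]; apply: is_deriveB; [apply: dK1|apply: dK2]; lra.
Qed.

(** As for the cosine, with [u = c1 + r * cos t] and a single cut at pi. The derivative of [u] is
    [- (r * sin t)], which is why the substitution is made with [- k] and [- K]. *)
Lemma circle_integral_sin (H : R * R -> R) : continuous H ->
  \int[mu]_(u in `[c1 - r, c1 + r])
    (H (u, c2 + chord c1 u) - H (u, c2 - chord c1 u)) =
  \int[mu]_(t in `[0, 2 * pi]) (H (circle t) * (r * sin t)).
Proof.
move=> cH; have pi0 := pi_gt0 R; have rp := r0.
have cr : c1 - r <= c1 + r by lra.
pose k (e u : R) := H (u, c2 + e * chord c1 u).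
have ck e : continuous (k e).
  move=> u; apply: (@continuous_comp _ _ _ (fun u => (u, c2 + e * chord c1 u)) H);
    last exact: cH.
  apply: continuous_pair; first exact: cvg_id.
  apply: cvgD; first exact: cvg_cst.
  by apply: cvgM; [exact: cvg_cst|exact: chord_continuous].
have [K1 dK1] := antiderivative (c1 - r - 1) (ck 1).
have [K2 dK2] := antiderivative (c1 - r - 1) (ck (-1)).
have cint : continuous (fun t => H (circle t) * (r * sin t)).
  move=> t; apply: cvgM.
    by apply: continuous_comp; [exact: circle_continuous|exact: cH].
  by apply: cvgM; [exact: cvg_cst|exact: continuous_sin].
have piece e K : (forall x, c1 - r - 1 < x -> is_derive x 1 K (k e x)) ->
    forall a b, a <= b -> (forall t, a <= t <= b -> e * `|sin t| = sin t) ->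
    \int[mu]_(t in `[a, b]) (H (circle t) * (r * sin t)) =
    K (c1 + r * cos a) - K (c1 + r * cos b).
  move=> dK a b ab sg.
  have E t : a <= t <= b ->
      - k e (c1 + r * cos t) * (- (r * sin t)) = H (circle t) * (r * sin t).
    by move=> /sg tE; rewrite mulrNN /k chord_cos (mulrCA e) tE.
  transitivity (\int[mu]_(t in `[a, b]) (- k e (c1 + r * cos t) * (- (r * sin t)))).
    by apply: eq_Rintegral => t; rewrite inE/= in_itv/= => /E.
  rewrite -[RHS]opprK opprB addrC opprD addrC.
  apply: (@Rintegral_substitution (fun u => - k e u) (fun u => - K u)
    (fun t => c1 + r * cos t) (fun t => - (r * sin t))) => //.
  - move=> t _; apply: is_deriveN; apply: dK => /=.
    have : 0 <= r * (cos t + 1).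
      by apply: mulr_ge0; [exact: ltW|have := cos_geN1 t; lra].
    by rewrite mulrDr; lra.
  - move=> t _; apply: cvgM.
      apply: cvgN.
      apply: (@continuous_comp _ _ _ (fun t => c1 + r * cos t)); last exact: ck.
      apply: cvgD; first exact: cvg_cst.
      by apply: cvgM; [exact: cvg_cst|exact: continuous_cos].
    by apply: cvgN; apply: cvgM; [exact: cvg_cst|exact: continuous_sin].
rewrite (Rintegral_itv_cat (b := pi) cint); [|lra|lra].
rewrite (piece 1 K1)//; [|lra|]; last first.
  by move=> t t01; rewrite mul1r ger0_norm// sin_ge0_pi.
rewrite (piece (-1) K2)//; [|lra|]; last first.
  move=> t /andP[t0 t1]; rewrite -{2}(subrK pi t) sinDpi mulN1r; congr (- _).
  rewrite -(subrK pi t) sinDpi normrN ger0_norm// ?addrK// sin_ge0_pi//; lra.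
have -> : 2 * pi = 0 + pi *+ 2 :> R by rewrite (mulr2n pi); lra.
rewrite cosD2pi cos0 cospi mulr1 mulrN1.
transitivity ((K1 (c1 + r) - K2 (c1 + r)) - (K1 (c1 - r) - K2 (c1 - r))); last by ring.
have kE u : k 1 u - k (-1) u = H (u, c2 + chord c1 u) - H (u, c2 - chord c1 u).
  by rewrite /k mul1r mulN1r.
transitivity (\int[mu]_(u in `[c1 - r, c1 + r]) (k 1 u - k (-1) u)).
  by apply: eq_Rintegral => u _; rewrite kE.
apply: (FTC_segment (F := fun u => K1 u - K2 u) cr).
  by move=> u _; apply: cvgB; exact: ck.
by move=> u /andP[u1 u2]; apply: is_deriveB; [apply: dK1|apply: dK2]; lra.
Qed.

Local Notation B := (box (c1 - r) (c1 + r) (c2 - r) (c2 + r)).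

Let abs_lt u v : u ^+ 2 + v ^+ 2 < r ^+ 2 -> - r < u < r.
Proof.
move=> h; rewrite -ltr_norml ltNge; apply/negP => ru.
have : r ^+ 2 <= `|u| ^+ 2 by rewrite lerXn2r// nnegrE ltW.
by rewrite real_normK ?num_real//; have := sqr_ge0 v; lra.
Qed.

Lemma disc_box : disc `<=` B.
Proof.
move=> z; rewrite /disc/= => h; have h1 := abs_lt h.
by move: h; rewrite addrC => /abs_lt h2; split => /=; lra.
Qed.

Lemma circle_box t : B (circle t).
Proof.
have rp := r0; have := cos_geN1 t; have := cos_le1 t.
have := sin_geN1 t; have := sin_le1 t.
by move=> h1 h2 h3 h4; split => /=; nra.
Qed.

Lemma open_disc : open disc.
Proof.
have c : continuous (fun z : R * R => (z.1 - c1) ^+ 2 + (z.2 - c2) ^+ 2).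
  move=> z; apply: cvgD; rewrite expr2; under eq_fun do rewrite expr2;
    by apply: cvgM; apply: cvgB; try exact: cvg_cst;
    first [exact: cvg_fst|exact: cvg_snd].
by rewrite (_ : disc = (fun z => (z.1 - c1) ^+ 2 + (z.2 - c2) ^+ 2) @^-1`
    [set x | x < r ^+ 2])//;
  apply: open_comp => [z _|]; [exact: c|exact: open_lt].
Qed.

Lemma measurable_disc : measurable (disc : set R2).
Proof. by apply: open_measurable2; exact: open_disc. Qed.

Let chordP c x v : - r < x - c < r ->
  ((x - c) ^+ 2 + v ^+ 2 < r ^+ 2) = (- chord c x < v < chord c x).
Proof.
move=> xr; have s0 : 0 <= chord c x by exact: sqrtr_ge0.
have s2 : chord c x ^+ 2 = r ^+ 2 - (x - c) ^+ 2 by rewrite sqr_sqrtr//; nra.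
rewrite -ltr_norml -[`|v| < _](@ltr_pXn2r _ 2)// ?nnegrE// real_normK ?num_real// s2.
by apply/idP/idP; lra.
Qed.

Let chord_le c x : chord c x <= r.
Proof.
have rp := r0; rewrite -[leRHS](gtr0_norm rp) -sqrtr_sqr ler_sqrt ?sqr_ge0//.
by rewrite gerBl sqr_ge0.
Qed.

(** Each term is integrated along its own coordinate, which leaves differences at the two ends of a
    chord; the two circle integrals turn these into integrals over the angle, with outer normal (cos
    t, sin t) and length element r dt. *)
Theorem disc_divergence (F1 F2 f1 f2 : R * R -> R) :
  (forall z, B z -> is_derive z (e1 R) F1 (f1 z)) ->
  (forall z, B z -> is_derive z (e2 R) F2 (f2 z)) ->
  (forall z, B z -> {for z, continuous F1}) ->
  (forall z, B z -> {for z, continuous F2}) ->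
  (forall z, B z -> {for z, continuous f1}) ->
  (forall z, B z -> {for z, continuous f2}) ->
  \int[mu2]_(z in disc) (f1 z + f2 z) =
  \int[mu]_(t in `[0, 2 * pi])
    ((F1 (circle t) * cos t + F2 (circle t) * sin t) * r).
Proof.
move=> dF1 dF2 cF1 cF2 cf1 cf2; have rp := r0; have pi0 := pi_gt0 R.
have ab : c1 - r <= c1 + r by lra.
have cd : c2 - r <= c2 + r by lra.
(* The fields are controlled only on the bounding box, while the integrals over chords and circle
   are set up for globally continuous functions. *)
have [G1 [cG1 G1E _]] := box_extension ab cd cF1.
have [G2 [cG2 G2E _]] := box_extension ab cd cF2.
have ch0 c x : 0 <= chord c x by exact: sqrtr_ge0.
have i1 := box_integrable ab cd measurable_disc disc_box cf1.
have i2 := box_integrable ab cd measurable_disc disc_box cf2.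
have c1c : continuous (fun t => G1 (circle t) * (r * cos t)).
  move=> t; apply: cvgM.
    by apply: continuous_comp; [exact: circle_continuous|exact: cG1].
  by apply: cvgM; [exact: cvg_cst|exact: continuous_cos].
have c2c : continuous (fun t => G2 (circle t) * (r * sin t)).
  move=> t; apply: cvgM.
    by apply: continuous_comp; [exact: circle_continuous|exact: cG2].
  by apply: cvgM; [exact: cvg_cst|exact: continuous_sin].
have cD c e : continuous (fun x => e + chord c x).
  by move=> x; apply: cvgD; [exact: cvg_cst|exact: chord_continuous].
have cB c e : continuous (fun x => e - chord c x).
  by move=> x; apply: cvgB; [exact: cvg_cst|exact: chord_continuous].
have cHx (h : R -> R) : continuous h -> continuous (fun y => G1 (h y, y)).
  move=> ch y; apply: (@continuous_comp _ _ _ (fun y => (h y, y)) G1); last exact: cG1.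
  by apply: continuous_pair; [exact: ch|exact: cvg_id].
have cHy (h : R -> R) : continuous h -> continuous (fun x => G2 (x, h x)).
  move=> ch x; apply: (@continuous_comp _ _ _ (fun x => (x, h x)) G2); last exact: cG2.
  by apply: continuous_pair; [exact: cvg_id|exact: ch].
rewrite RintegralD//; last exact: measurable_disc.
transitivity (\int[mu]_(t in `[0, 2 * pi]) (G1 (circle t) * (r * cos t)) +
              \int[mu]_(t in `[0, 2 * pi]) (G2 (circle t) * (r * sin t))).
  congr (_ + _).
    rewrite -circle_integral_cos//.
    apply: (@green_ysection _ _ _ _ _ _ _ _ ab cd measurable_disc disc_box cf1
      (fun y => c1 - chord c2 y) (fun y => c1 + chord c2 y)
      _ false true false true _ dF1).
      by move=> y; apply: cvgB; [apply: (cHx _ (cD _ _))|apply: (cHx _ (cB _ _))].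
    move=> y; rewrite in_itv/= => yb.
    have yb' : - r < y - c2 < r by lra.
    have := ch0 c2 y; have := chord_le c2 y => h1 h2; split; [|lra|lra|lra|].
      apply/seteqP; split=> x; rewrite /ysection/= inE /disc/= in_itv/=
        (addrC ((x - c1) ^+ 2)) chordP//; lra.
    by rewrite !G1E//; split => /=; lra.
  rewrite -circle_integral_sin//.
  apply: (@green_xsection _ _ _ _ _ _ _ _ ab cd measurable_disc disc_box cf2
    (fun x => c2 - chord c1 x) (fun x => c2 + chord c1 x) _ false true false true _ dF2).
    by move=> x; apply: cvgB; [apply: (cHy _ (cD _ _))|apply: (cHy _ (cB _ _))].
  move=> x; rewrite in_itv/= => xb.
  have xb' : - r < x - c1 < r by lra.
  have := ch0 c1 x; have := chord_le c1 x => h1 h2; split; [|lra|lra|lra|].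
    apply/seteqP; split=> y; rewrite /xsection/= inE /disc/= in_itv/= chordP//; lra.
  by rewrite !G2E//; split => /=; lra.
rewrite -RintegralD//; try by apply: continuous_segment_integrable => t _;
  first [exact: c1c|exact: c2c].
by apply: eq_Rintegral => t _; rewrite !G1E ?G2E; [ring|exact: circle_box..].
Qed.

End circle_integrals.
End circle.

(** * Calculus of functions of two variables *)

Section partial_derivatives.
Context {R : realType}.
Implicit Types (f p q s : R * R -> R) (z : R * R) (U : set (R * R)).

Lemma nbhs_square z (P : set (R * R)) : nbhs z P ->
  exists2 d : R, 0 < d &
    forall x y, `|x - z.1| <= d -> `|y - z.2| <= d -> P (x, y).
Proof.
move=> /nbhs_ballP[e /= e0 eP]; exists (e / 2); first by rewrite divr_gt0.
move=> x y xe ye; apply: eP; split; rewrite /ball/= distrC; lra.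
Qed.

(** The increment [k] may have either sign, as do the increments [h * a] and [h * b] of a
    directional derivative. *)
Lemma MVT_symmetric (g dg : R -> R) (u k : R) :
  (forall t, `|t - u| <= `|k| -> is_derive t 1 g (dg t)) ->
  exists2 c, `|c - u| <= `|k| & g (u + k) - g u = dg c * k.
Proof.
move=> dgE.
have cg t : `|t - u| <= `|k| -> {for t, continuous g}.
  by move=> /dgE[h _]; exact/differentiable_continuous/derivable1_diffP.
have [k0|k0] := leP 0 k.
  have B t : t \in `[u, u + k] -> `|t - u| <= `|k|.
    by rewrite in_itv/= => /andP[? ?]; rewrite !ger0_norm; lra.
  have [|||c cu E] := @MVT_segment _ g dg u (u + k).
  - by rewrite lerDl.
  - by move=> x xu; apply: dgE; apply: B; exact: subset_itv_oo_cc xu.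
  - by apply: continuous_in_subspaceT => x /[1!inE] /B/cg.
  - by exists c; [exact: B|rewrite E addrAC subrr add0r].
have B t : t \in `[u + k, u] -> `|t - u| <= `|k|.
  by rewrite in_itv/= => /andP[? ?]; rewrite ler0_norm ?ltr0_norm; lra.
have [|||c cu E] := @MVT_segment _ g dg (u + k) u.
- by rewrite gerDl ltW.
- by move=> x xu; apply: dgE; apply: B; exact: subset_itv_oo_cc xu.
- by apply: continuous_in_subspaceT => x /[1!inE] /B/cg.
- by exists c; [exact: B|rewrite -opprB E; ring].
Qed.

(** The second difference of [f] over a square of side d with corner [z] is d^2 times a nearby value
    of [s] (mean values first in x, then in y) and also d^2 times a nearby value of [s'] (the other
    order); continuity at [z] then forces equality. *)
Lemma schwarz f p q s s' U z : open U -> U z ->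
  (forall w, U w -> is_derive w (e1 R) f (p w)) ->
  (forall w, U w -> is_derive w (e2 R) f (q w)) ->
  (forall w, U w -> is_derive w (e2 R) p (s w)) ->
  (forall w, U w -> is_derive w (e1 R) q (s' w)) ->
  {for z, continuous s} -> {for z, continuous s'} -> s z = s' z.
Proof.
case: z => x y oU Uz df1 df2 dp2 dq1 cs cs'.
apply/eqP; rewrite -subr_eq0 -normr_le0; apply/ler_addgt0Pr => e e0.
have e20 : 0 < e / 2 by rewrite divr_gt0.
have near_s : nbhs (x, y) [set w | [/\ U w, `|s (x, y) - s w| <= e / 2 &
    `|s' (x, y) - s' w| <= e / 2]].
  have h1 : \forall w \near (x, y), U w by exact: open_nbhs_nbhs.
  have h2 : \forall w \near (x, y), `|s (x, y) - s w| <= e / 2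
    by move/cvgrPdist_le : cs; apply.
  have h3 : \forall w \near (x, y), `|s' (x, y) - s' w| <= e / 2
    by move/cvgrPdist_le : cs'; apply.
  by near=> w; split; near: w.
have [d d0 dP] := nbhs_square near_s.
have dd : d = `|d| by rewrite gtr0_norm.
have dn : `|y + d - y| <= d by rewrite addrAC subrr add0r -dd.
have dn' : `|x + d - x| <= d by rewrite addrAC subrr add0r -dd.
have yn : `|y - y| <= d by rewrite subrr normr0 ltW.
have xn : `|x - x| <= d by rewrite subrr normr0 ltW.
pose D := f (x + d, y + d) - f (x + d, y) - (f (x, y + d) - f (x, y)).
have [xi xid E1] : exists2 c, `|c - x| <= `|d| &
    D = (p (c, y + d) - p (c, y)) * d.
  apply: (@MVT_symmetric (fun t => f (t, y + d) - f (t, y))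
    (fun t => p (t, y + d) - p (t, y))) => t; rewrite -dd => td.
  by apply: is_deriveB; apply/is_derive_e1P; apply: df1;
    have [] := dP _ _ td dn; have [] := dP _ _ td yn.
have [eta etad E2] : exists2 c, `|c - y| <= `|d| &
    p (xi, y + d) - p (xi, y) = s (xi, c) * d.
  apply: (@MVT_symmetric (fun t => p (xi, t)) (fun t => s (xi, t))) => t.
  rewrite -dd in xid *; move=> td.
  by apply/is_derive_e2P; apply: dp2; have [] := dP _ _ xid td.
have [eta' etad' E1'] : exists2 c, `|c - y| <= `|d| &
    f (x + d, y + d) - f (x, y + d) - (f (x + d, y) - f (x, y)) =
    (q (x + d, c) - q (x, c)) * d.
  apply: (@MVT_symmetric (fun t => f (x + d, t) - f (x, t))
    (fun t => q (x + d, t) - q (x, t))) => t; rewrite -dd => td.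
  by apply: is_deriveB; apply/is_derive_e2P; apply: df2;
    have [] := dP _ _ dn' td; have [] := dP _ _ xn td.
have [xi' xid' E2'] : exists2 c, `|c - x| <= `|d| &
    q (x + d, eta') - q (x, eta') = s' (c, eta') * d.
  apply: (@MVT_symmetric (fun t => q (t, eta')) (fun t => s' (t, eta'))) => t.
  rewrite -dd in etad' *; move=> td.
  by apply/is_derive_e1P; apply: dq1; have [] := dP _ _ td etad'.
have ss : s (xi, eta) = s' (xi', eta').
  have d2 : d * d != 0 by rewrite mulf_neq0// lt0r_neq0.
  apply: (mulIf d2); rewrite !mulrA -E2 -E2' -E1 -E1' /D; ring.
rewrite -dd in xid etad xid' etad'.
have [_ h _] := dP _ _ xid etad; have [_ _ h'] := dP _ _ xid' etad'.
have -> : s (x, y) - s' (x, y) = (s (x, y) - s (xi, eta)) - (s' (x, y) - s' (xi', eta')).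
  by rewrite ss; ring.
by rewrite add0r (le_trans (ler_normB _ _))// [leRHS](splitr e) lerD.
Unshelve. all: by end_near. Qed.

(** Expresses the normal derivative in the boundary integral by the partial derivatives. The
    increment is split into a horizontal and a vertical leg, each handled by the mean value theorem;
    continuity of [p] and [q] absorbs the displacement. *)
Lemma is_derive_direction f p q U z (a b : R) : open U -> U z ->
  (forall w, U w -> is_derive w (e1 R) f (p w)) ->
  (forall w, U w -> is_derive w (e2 R) f (q w)) ->
  {for z, continuous p} -> {for z, continuous q} ->
  is_derive z (a, b) f (a * p z + b * q z).
Proof.
case: z => x y oU Uz df1 df2 cp cq.
suff h : (fun h => h^-1 *: (f (h *: (a, b) + (x, y)) - f (x, y))) @ (0 : R)^' -->
    a * p (x, y) + b * q (x, y).
  by apply: DeriveDef; [apply/cvg_ex; exists (a * p (x, y) + b * q (x, y))|exact/cvg_lim].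
apply/cvgrPdist_le => e e0.
(* An error of [e / m] in each partial derivative adds up to at most [e], and [|h| <= d / m] keeps
   both legs inside the square; the 1 keeps [m] positive when the direction is zero. *)
pose m := `|a| + `|b| + 1.
have m0 : 0 < m by rewrite /m; have := normr_ge0 a; have := normr_ge0 b; lra.
have em0 : 0 < e / m by rewrite divr_gt0.
have near_pq : nbhs (x, y) [set w | [/\ U w, `|p (x, y) - p w| <= e / m &
    `|q (x, y) - q w| <= e / m]].
  have h1 : \forall w \near (x, y), U w by exact: open_nbhs_nbhs.
  have h2 : \forall w \near (x, y), `|p (x, y) - p w| <= e / m
    by move/cvgrPdist_le : cp; apply.
  have h3 : \forall w \near (x, y), `|q (x, y) - q w| <= e / m
    by move/cvgrPdist_le : cq; apply.
  by near=> w; split; near: w.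
have [d d0 dP] := nbhs_square near_pq.
near=> h.
have h0 : h != 0 by near: h; exact: nbhs_dnbhs_neq.
have hd : `|h| <= d / m.
  near: h; apply: dnbhs0_le; exact: divr_gt0.
have hk k : `|k| <= m -> `|h * k| <= d.
  move=> km; rewrite normrM; apply: (le_trans (ler_pM _ _ hd km)) => //.
  by rewrite divfK// lt0r_neq0.
have ha : `|h * a| <= d by apply: hk; rewrite /m; have := normr_ge0 b; lra.
have hb : `|h * b| <= d by apply: hk; rewrite /m; have := normr_ge0 a; lra.
have yb : `|y + h * b - y| <= d by rewrite addrAC subrr add0r.
have xx : `|x - x| <= d by rewrite subrr normr0 ltW.
have [xi xih E1] : exists2 c, `|c - x| <= `|h * a| &
    f (x + h * a, y + h * b) - f (x, y + h * b) = p (c, y + h * b) * (h * a).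
  apply: (@MVT_symmetric (fun t => f (t, y + h * b)) (fun t => p (t, y + h * b))) => t th.
  by apply/is_derive_e1P; apply: df1; have [] := dP _ _ (le_trans th ha) yb.
have [eta etah E2] : exists2 c, `|c - y| <= `|h * b| &
    f (x, y + h * b) - f (x, y) = q (x, c) * (h * b).
  apply: (@MVT_symmetric (fun t => f (x, t)) (fun t => q (x, t))) => t th.
  by apply/is_derive_e2P; apply: df2; have [] := dP _ _ xx (le_trans th hb).
have [_ P1 _] := dP _ _ (le_trans xih ha) yb.
have [_ _ P2] := dP _ _ xx (le_trans etah hb).
have -> : h *: (a, b) + (x, y) = (x + h * a, y + h * b).
  by congr pair; rewrite /= addrC.
have -> : h^-1 *: (f (x + h * a, y + h * b) - f (x, y)) =
    a * p (xi, y + h * b) + b * q (x, eta).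
  have -> : f (x + h * a, y + h * b) - f (x, y) =
      p (xi, y + h * b) * (h * a) + q (x, eta) * (h * b) by rewrite -E1 -E2; ring.
  by rewrite /GRing.scale/=; field.
have -> : a * p (x, y) + b * q (x, y) - (a * p (xi, y + h * b) + b * q (x, eta)) =
    a * (p (x, y) - p (xi, y + h * b)) + b * (q (x, y) - q (x, eta)) by ring.
rewrite (le_trans (ler_normD _ _))// !normrM.
apply: (@le_trans _ _ (`|a| * (e / m) + `|b| * (e / m))).
  by rewrite lerD// ler_wpM2l.
rewrite -mulrDl -[leRHS](divfK (lt0r_neq0 m0)) mulrC ler_wpM2l//; first exact: ltW.
by rewrite /m; lra.
Unshelve. all: by end_near. Qed.

End partial_derivatives.

Section eigen_data.
Context {R : realType}.
Local Notation HH := (@upper_half_plane R).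

Lemma open_upper_half_plane : open HH.
Proof.
rewrite (_ : HH = snd @^-1` [set x : R | 0 < x])//; apply: open_comp.
  by move=> z _; exact: cvg_snd.
exact: open_gt.
Qed.

(** Monge's notation for the partial derivatives up to order two. That [ed_p2] and [ed_q1] share the
    same [s] is the symmetry of the mixed derivatives; with the derivatives as variables, the
    identities below are rational in these functions and the coordinates. *)
Record eigen_data (lam : R) (f p q r s t : R * R -> R) : Prop := EigenData {
  ed_f1 : forall z, HH z -> is_derive z (e1 R) f (p z);
  ed_f2 : forall z, HH z -> is_derive z (e2 R) f (q z);
  ed_p1 : forall z, HH z -> is_derive z (e1 R) p (r z);
  ed_p2 : forall z, HH z -> is_derive z (e2 R) p (s z);
  ed_q1 : forall z, HH z -> is_derive z (e1 R) q (s z);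
  ed_q2 : forall z, HH z -> is_derive z (e2 R) q (t z);
  ed_f : forall z, HH z -> {for z, continuous f};
  ed_p : forall z, HH z -> {for z, continuous p};
  ed_q : forall z, HH z -> {for z, continuous q};
  ed_r : forall z, HH z -> {for z, continuous r};
  ed_s : forall z, HH z -> {for z, continuous s};
  ed_t : forall z, HH z -> {for z, continuous t};
  ed_eq : forall z, HH z -> r z + t z = - (lam * f z) / z.2 ^+ 2
}.

Lemma eigen_dataP (lam : R) (f : R * R -> R) : Ck_on 2 HH f ->
  (forall z, HH z -> hlaplacian f z = lam * f z) ->
  exists r s t, eigen_data lam f ('D_(e1 R) f) ('D_(e2 R) f) r s t.
Proof.
move=> [cf [df [cp [dp cpp cpq]] [cq [dq cqp cqq]]]] fE.
pose p := 'D_(e1 R) f; pose q := 'D_(e2 R) f.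
exists ('D_(e1 R) p), ('D_(e2 R) p), ('D_(e2 R) q).
have f1 z : HH z -> is_derive z (e1 R) f (p z).
  by move=> /df[h _]; apply/derivableP.
have f2 z : HH z -> is_derive z (e2 R) f (q z).
  by move=> /df[_ h]; apply/derivableP.
have p2 z : HH z -> is_derive z (e2 R) p ('D_(e2 R) p z).
  by move=> /dp[_ h]; apply/derivableP.
have q1 z : HH z -> is_derive z (e1 R) q ('D_(e1 R) q z).
  by move=> /dq[h _]; apply/derivableP.
have sw z : HH z -> 'D_(e2 R) p z = 'D_(e1 R) q z.
  move=> Hz; apply: (schwarz open_upper_half_plane Hz f1 f2 p2 q1).
    by have [+ _] := cpq; exact.
  by have [+ _] := cqp; exact.
split=> z Hz.
- exact: f1.
- exact: f2.
- by have [h _] := dp _ Hz; apply/derivableP.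
- exact: p2.
- by rewrite sw//; exact: q1.
- by have [_ h] := dq _ Hz; apply/derivableP.
- exact: cf.
- exact: cp.
- exact: cq.
- by have [+ _] := cpp; apply.
- by have [+ _] := cpq; apply.
- by have [+ _] := cqq; apply.
- have z20 : z.2 != 0 by exact: lt0r_neq0.
  have alg (y l a b : R) : y != 0 -> - (y ^+ 2 * (a + b)) = l -> a + b = - l / y ^+ 2.
    by move=> y0 <-; field.
  exact: alg z20 (fE _ Hz).
Qed.

End eigen_data.

(** * The Rellich field of a disc *)

Section continuity.
Context {R : realType} {T : topologicalType}.
Implicit Types (f g : T -> R) (z : T).

(** A named form of continuity at a point that keeps the function visible as a lambda, on whose
    shape the tactic [continuity] recurses. *)
Definition cont_at z f := {for z, continuous f}.

Lemma cont_atD f g z : cont_at z f -> cont_at z g -> cont_at z (fun w => f w + g w).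
Proof. by move=> cf cg; apply: cvgD. Qed.

Lemma cont_atN f z : cont_at z f -> cont_at z (fun w => - f w).
Proof. by move=> cf; apply: cvgN. Qed.

Lemma cont_atM f g z : cont_at z f -> cont_at z g -> cont_at z (fun w => f w * g w).
Proof. by move=> cf cg; apply: cvgM. Qed.

Lemma cont_atX f n z : cont_at z f -> cont_at z (fun w => f w ^+ n).
Proof.
move=> cf; apply: (@continuous_comp _ _ _ f (fun x => x ^+ n)) => //.
exact: exprn_continuous.
Qed.

Lemma cont_atV f z : f z != 0 -> cont_at z f -> cont_at z (fun w => (f w)^-1).
Proof. by move=> f0 cf; apply: cvgV. Qed.

Lemma cont_at_cst (c : R) z : cont_at z (fun=> c).
Proof. exact: cvg_cst. Qed.

End continuity.

Lemma cont_at_fst (R : realType) (z : R * R) : cont_at z (fun w => w.1).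
Proof. exact: cvg_fst. Qed.

Lemma cont_at_snd (R : realType) (z : R * R) : cont_at z (fun w => w.2).
Proof. exact: cvg_snd. Qed.

Ltac continuity :=
  lazymatch goal with
  | h : cont_at ?z ?f |- cont_at ?z ?f => exact h
  | |- cont_at _ (fun _ => ?c) => exact: cont_at_cst
  | |- cont_at _ (fun w => @?f w + @?g w) => apply: (@cont_atD _ _ f g); continuity
  | |- cont_at _ (fun w => - @?f w) => apply: (@cont_atN _ _ f); continuity
  | |- cont_at _ (fun w => @?f w * @?g w) => apply: (@cont_atM _ _ f g); continuity
  | |- cont_at _ (fun w => @?f w ^+ ?n) => apply: (@cont_atX _ _ f n); continuity
  | |- cont_at _ (fun w => (@?f w)^-1) => apply: (@cont_atV _ _ f); [try done|continuity]
  | |- cont_at _ (fun w => w.1) => exact: cont_at_fst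
  | |- cont_at _ (fun w => w.2) => exact: cont_at_snd
  | |- _ => idtac
  end.

Section coordinates.
Context {R : realType}.

(** As instances, the coordinate derivatives let instance search differentiate the fields below,
    whose coefficients are polynomial in the coordinates. *)
Global Instance is_derive_fst (z v : R * R) : is_derive z v fst v.1.
Proof.
have h : (fun h : R => h^-1 *: ((h *: v + z).1 - z.1)) @ (0 : R)^' --> v.1.
  apply: cvg_near_cst; near=> h.
  have h0 : h != 0 by near: h; exact: nbhs_dnbhs_neq.
  by rewrite /= addrK scalerA mulVf// scale1r.
by apply: DeriveDef; [apply/cvg_ex; exists v.1|exact/cvg_lim].
Unshelve. all: by end_near. Qed.

Global Instance is_derive_snd (z v : R * R) : is_derive z v snd v.2.
Proof.
have h : (fun h : R => h^-1 *: ((h *: v + z).2 - z.2)) @ (0 : R)^' --> v.2.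
  apply: cvg_near_cst; near=> h.
  have h0 : h != 0 by near: h; exact: nbhs_dnbhs_neq.
  by rewrite /= addrK scalerA mulVf// scale1r.
by apply: DeriveDef; [apply/cvg_ex; exists v.2|exact/cvg_lim].
Unshelve. all: by end_near. Qed.

Lemma is_derive_inv_snd (z v : R * R) : z.2 != 0 ->
  is_derive z v (fun w => w.2^-1) (- z.2^-1 ^+ 2 * v.2).
Proof.
move=> z0; have [dz zE] := is_derive_snd z v.
have dV := derivableV z0 dz.
apply: DeriveDef; first exact: dV.
have := deriveV z0 dz; rewrite zE => /= ->.
by rewrite exprVn.
Qed.

End coordinates.

Section disc_fields.
Context {R : realType}.
Variables (x0 b lam : R) (f p q r s t : R * R -> R).
Hypothesis ed : eigen_data lam f p q r s t.
Local Notation HH := (@upper_half_plane R).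

(* [(dilation1, dilation2) / (2 b)] is the field zeta d/dzeta in the disc
   coordinate zeta = (z - x0 - i b) / (z - x0 + i b). *)
Definition dilation1 (z : R * R) : R := 2 * (z.1 - x0) * z.2.
Definition dilation2 (z : R * R) : R := z.2 ^+ 2 - (z.1 - x0) ^+ 2 - b ^+ 2.

(** [disc_field1] and [disc_field2] are the components of the field F for X = ([dilation1],
    [dilation2]), with the gradient terms collected as X1 (p^2 - q^2) + 2 X2 p q and X2 (q^2 - p^2)
    + 2 X1 p q. *)
Definition disc_field1 (z : R * R) : R :=
  dilation1 z * (p z ^+ 2 - q z ^+ 2) + 2 * (dilation2 z * (p z * q z)) +
  lam * (f z ^+ 2 * (dilation1 z * z.2^-1 ^+ 2)).

Definition disc_field2 (z : R * R) : R :=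
  dilation2 z * (q z ^+ 2 - p z ^+ 2) + 2 * (dilation1 z * (p z * q z)) +
  lam * (f z ^+ 2 * (dilation2 z * z.2^-1 ^+ 2)).

Definition disc_field1_e1 (z : R * R) : R :=
  2 * z.2 * (p z ^+ 2 - q z ^+ 2) + dilation1 z * (2 * p z * r z - 2 * q z * s z) +
  2 * (- (2 * (z.1 - x0)) * (p z * q z) + dilation2 z * (r z * q z + p z * s z)) +
  lam * (2 * f z * p z * (dilation1 z * z.2^-1 ^+ 2) +
    f z ^+ 2 * (2 * z.2 * z.2^-1 ^+ 2)).

Definition disc_field2_e2 (z : R * R) : R :=
  2 * z.2 * (q z ^+ 2 - p z ^+ 2) + dilation2 z * (2 * q z * t z - 2 * p z * s z) +
  2 * (2 * (z.1 - x0) * (p z * q z) + dilation1 z * (s z * q z + p z * t z)) +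
  lam * (2 * f z * q z * (dilation2 z * z.2^-1 ^+ 2) +
    f z ^+ 2 * (2 * z.2 * z.2^-1 ^+ 2 - 2 * (dilation2 z * z.2^-1 ^+ 3))).

(** The terms quadratic in the gradient cancel by the Cauchy-Riemann equations of the dilation
    field: both diagonal derivatives are 2 y, the off-diagonal ones are opposite. The equation
    eliminates [r], and lambda f^2 div (y^-2 X) remains. *)
Lemma disc_divergenceE z : HH z ->
  disc_field1_e1 z + disc_field2_e2 z =
  2 * lam * f z ^+ 2 * (z.2 ^+ 2 + (z.1 - x0) ^+ 2 + b ^+ 2) / z.2 ^+ 3.
Proof.
move=> Hz; have z0 : z.2 != 0 by exact: lt0r_neq0.
rewrite /disc_field1_e1 /disc_field2_e2 /dilation1 /dilation2.
have -> : r z = - (lam * f z) / z.2 ^+ 2 - t z by rewrite -(ed_eq ed Hz) addrK.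
move: (f z) (p z) (q z) (s z) (t z) (z.1) (z.2) z0 => F P Q S T x y y0.
by field.
Qed.

Lemma is_derive_disc_field1 z : HH z ->
  is_derive z (e1 R) disc_field1 (disc_field1_e1 z).
Proof.
move=> Hz; have z0 : z.2 != 0 by exact: lt0r_neq0.
have := ed_f1 ed Hz; have := ed_p1 ed Hz; have := ed_q1 ed Hz.
have := is_derive_inv_snd (e1 R) z0.
move=> d1 d2 d3 d4; rewrite /disc_field1 /dilation1 /dilation2.
apply: is_derive_eq.
rewrite /disc_field1_e1 /dilation1 /dilation2 /GRing.scale /=.
ring.
Qed.

Lemma is_derive_disc_field2 z : HH z ->
  is_derive z (e2 R) disc_field2 (disc_field2_e2 z).
Proof.
move=> Hz; have z0 : z.2 != 0 by exact: lt0r_neq0.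
have := ed_f2 ed Hz; have := ed_p2 ed Hz; have := ed_q2 ed Hz.
have := is_derive_inv_snd (e2 R) z0.
move=> d1 d2 d3 d4; rewrite /disc_field2 /dilation1 /dilation2.
apply: is_derive_eq.
rewrite /disc_field2_e2 /dilation1 /dilation2 /GRing.scale /=.
ring.
Qed.

Lemma disc_fields_continuous z : HH z ->
  [/\ {for z, continuous disc_field1}, {for z, continuous disc_field2},
      {for z, continuous disc_field1_e1} & {for z, continuous disc_field2_e2}].
Proof.
move=> Hz; have z0 : z.2 != 0 by exact: lt0r_neq0.
have cf := ed_f ed Hz; have cp := ed_p ed Hz; have cq := ed_q ed Hz.
have cr := ed_r ed Hz; have cs := ed_s ed Hz; have ct := ed_t ed Hz.
have cf' : cont_at z (fun z => f z) by [].
have cp' : cont_at z (fun z => p z) by [].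
have cq' : cont_at z (fun z => q z) by [].
have cr' : cont_at z (fun z => r z) by [].
have cs' : cont_at z (fun z => s z) by [].
have ct' : cont_at z (fun z => t z) by [].
split.
- change (cont_at z disc_field1); rewrite /disc_field1 /dilation1 /dilation2; continuity.
- change (cont_at z disc_field2); rewrite /disc_field2 /dilation1 /dilation2; continuity.
- change (cont_at z disc_field1_e1); rewrite /disc_field1_e1 /dilation1 /dilation2;
    continuity.
- change (cont_at z disc_field2_e2); rewrite /disc_field2_e2 /dilation1 /dilation2;
    continuity.
Qed.

(* On the circle of centre (x0, b cosh rho) and radius r = b sinh rho the
   conformal field (dilation1, dilation2) is 2 y r times the Euclidean unit normal. *)
Lemma disc_flux_le (c d rad : R) z : HH z -> 0 <= rad ->
  c ^+ 2 + d ^+ 2 = 1 ->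
  dilation1 z = 2 * z.2 * rad * c -> dilation2 z = 2 * z.2 * rad * d ->
  disc_field1 z * c + disc_field2 z * d <=
  2 * rad * (lam * f z ^+ 2 + (z.2 * c * p z + z.2 * d * q z) ^+ 2) / z.2.
Proof.
move=> Hz rad0 cd1 E1 E2.
have z0 : 0 < z.2 by [].
(* What the inequality gives away is the square of the tangential derivative. The second summand
   vanishes on the unit circle and makes the identity hold for arbitrary [c] and [d]. *)
rewrite -subr_ge0 (_ : _ - _ = 2 * z.2 * rad * (d * p z - c * q z) ^+ 2 +
    (1 - (c ^+ 2 + d ^+ 2)) * (2 * rad * lam * f z ^+ 2 / z.2)).
  by rewrite cd1 subrr mul0r addr0 mulr_ge0 ?sqr_ge0// !mulr_ge0// ltW.
rewrite /disc_field1 /disc_field2 E1 E2.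
move: (f z) (p z) (q z) (z.2) (lt0r_neq0 z0) => F P Q y' y0.
by field.
Qed.

End disc_fields.

(** * The inequality for a hyperbolic disc *)

Section disc_case.
Context {R : realType}.
Local Notation mu := (@lebesgue_measure R).
Local Notation mu2 := (@lebesgue_measure R \x @lebesgue_measure R)%E.
Local Notation R2 := (measurableTypeR R * measurableTypeR R)%type.
Local Notation HH := (@upper_half_plane R).

Lemma eigenfunction_parts (lam : R) (psi : R * R -> R[i]) :
  eigenfunction lam psi ->
  (exists r s t, eigen_data lam (rpart psi)
     ('D_(e1 R) (rpart psi)) ('D_(e2 R) (rpart psi)) r s t) /\
  (exists r s t, eigen_data lam (ipart psi)
     ('D_(e1 R) (ipart psi)) ('D_(e2 R) (ipart psi)) r s t).
Proof.
move=> [cr ci _ E]; split; apply: eigen_dataP => // z Hz; have := E z Hz.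
  move=> /(congr1 (@complex.Re R)) /= ->; rewrite /rpart.
  by case: (psi z) => a b /=; rewrite mul0r subr0.
move=> /(congr1 (@complex.Im R)) /= ->; rewrite /ipart.
by case: (psi z) => a b /=; rewrite mul0r addr0.
Qed.

(** The difference of the two sides is a multiple of (y - b)^2 + x^2. With [S] = sinh rho, the
    factor [2 * l * (b * S)] is the flux constant 2 lambda r. *)
Lemma disc_weight_le (l S b x y F G : R) : 0 < l -> 0 < S -> 0 < y ->
  2 * l * (b * S) * (2 / S * (F ^+ 2 + G ^+ 2) / y ^+ 2) <=
  2 * l * F ^+ 2 * (y ^+ 2 + x ^+ 2 + b ^+ 2) / y ^+ 3 +
  2 * l * G ^+ 2 * (y ^+ 2 + x ^+ 2 + b ^+ 2) / y ^+ 3.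
Proof.
move=> l0 S0 y0; rewrite -subr_ge0.
rewrite (_ : _ - _ = 2 * l * (F ^+ 2 + G ^+ 2) * ((y - b) ^+ 2 + x ^+ 2) / y ^+ 3).
  rewrite divr_ge0//; last by rewrite exprn_ge0// ltW.
  by rewrite !mulr_ge0// ?addr_ge0 ?sqr_ge0// ltW.
by field; rewrite !lt0r_neq0.
Qed.

(** Adds the flux bounds of the real and imaginary parts and extracts 2 lambda r; the factor [r / y]
    left over is the hyperbolic speed of the circle. *)
Lemma disc_flux_sum_le (l r y c d F G P Q a1 a2 a1' a2' : R) :
  0 < l -> 0 < r -> 0 < y ->
  a1 * c + a2 * d <= 2 * r * (l * F ^+ 2 + P ^+ 2) / y ->
  a1' * c + a2' * d <= 2 * r * (l * G ^+ 2 + Q ^+ 2) / y ->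
  ((a1 + a1') * c + (a2 + a2') * d) * r <=
  2 * l * r * ((F ^+ 2 + G ^+ 2 + l^-1 * (P ^+ 2 + Q ^+ 2)) * (r / y)).
Proof.
move=> l0 r0 y0 h1 h2.
rewrite (_ : 2 * l * r * _ = (2 * r * (l * F ^+ 2 + P ^+ 2) / y +
  2 * r * (l * G ^+ 2 + Q ^+ 2) / y) * r).
  by rewrite ler_pM2r//; lra.
by field; rewrite !lt0r_neq0.
Qed.

Lemma ltr_cosh (a c : R) : 0 <= a -> a < c -> cosh a < cosh c.
Proof.
move=> a0 ac; rewrite /cosh ltr_pM2r// !expRN.
have x0 : 0 < expR a by exact: expR_gt0.
have x1 : 1 <= expR a by rewrite -[leLHS]expR0 ler_expR.
have xy : expR a < expR c by rewrite ltr_expR.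
move: (expR a) (expR c) x0 x1 xy => x y x0 x1 xy.
have y0 : 0 < y by lra.
rewrite -subr_gt0 (_ : _ - _ = (y - x) * (x * y - 1) / (x * y)).
  by rewrite divr_gt0 ?mulr_gt0//; nra.
by field; rewrite !lt0r_neq0.
Qed.

Lemma arcosh_lt (u c : R) : 1 <= u -> 0 < c -> (arcosh u < c) = (u < cosh c).
Proof.
move=> u1 c0; have a0 : 0 <= arcosh u.
  by rewrite ln_ge0//; have := sqrtr_ge0 (u ^+ 2 - 1); lra.
apply/idP/idP => [h|]; first by rewrite -[ltLHS](coshK u1) ltr_cosh.
apply: contraTT; rewrite -!leNgt le_eqVlt => /predU1P[->|h]; first by rewrite coshK.
by rewrite -[leRHS](coshK u1) ltW// ltr_cosh// ltW.
Qed.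

Lemma hdisc_disc (w : R * R) (rho : R) : HH w -> 0 < rho ->
  hdisc w rho = disc w.1 (w.2 * cosh rho) (w.2 * sinh rho).
Proof.
move=> Hw rho0; have w0 : 0 < w.2 := Hw.
have sh0 := sinh_gt0 rho0; have ch0 := cosh_gt0 rho.
have cs := cosh2Bsinh2 rho.
have E z : (z.1 - w.1) ^+ 2 + (z.2 - w.2 * cosh rho) ^+ 2 - (w.2 * sinh rho) ^+ 2
    = (z.1 - w.1) ^+ 2 + (z.2 - w.2) ^+ 2 - (cosh rho - 1) * (2 * z.2 * w.2).
  have -> : (w.2 * sinh rho) ^+ 2 = w.2 ^+ 2 * (cosh rho ^+ 2 - 1).
    by rewrite exprMn; congr (_ * _); lra.
  by ring.
have main (z : R * R) : 0 < z.2 -> (hdist z w < rho) =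
    ((z.1 - w.1) ^+ 2 + (z.2 - w.2 * cosh rho) ^+ 2 < (w.2 * sinh rho) ^+ 2).
  move=> z0; have d0 : 0 < 2 * z.2 * w.2 by rewrite !mulr_gt0.
  have n0 : 0 <= (z.1 - w.1) ^+ 2 + (z.2 - w.2) ^+ 2 by rewrite addr_ge0 ?sqr_ge0.
  rewrite /hdist arcosh_lt//; last by rewrite lerDl divr_ge0// ltW.
  by rewrite -[RHS]subr_lt0 E subr_lt0 -(ltr_pdivrMr _ _ d0) [RHS]ltrBrDl.
apply/seteqP; split=> z.
  by move=> [z0 h]; rewrite /disc/= -main.
rewrite /disc/= => h.
have z0 : 0 < z.2.
  (* The Euclidean disc stays above the real axis: rewriting [E] with (z.2 + w.2)^2 replaces the
     coefficient cosh rho - 1 by cosh rho + 1, and for z.2 <= 0 every term on the right is visibly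
     nonnegative. *)
  rewrite ltNge; apply/negP => z0; move: (E z).
  have wz : 0 <= w.2 * (- z.2) by apply: mulr_ge0; [exact: ltW|lra].
  have ch1 : 0 < cosh rho + 1 by lra.
  have := mulr_ge0 wz (ltW ch1).
  have := sqr_ge0 (z.1 - w.1); have := sqr_ge0 (z.2 + w.2); nra.
by split; rewrite // main.
Qed.

Variables (w : R * R) (rho lam : R) (psi : R * R -> R[i]).
Hypotheses (Hw : HH w) (rho0 : 0 < rho) (lam0 : 0 < lam).
Hypothesis eig : eigenfunction lam psi.

Let b := w.2.
Let r := b * sinh rho.
Let c1 := w.1.
Let c2 := b * cosh rho.
Let b0 : 0 < b. Proof. exact: Hw. Qed.
Let r0 : 0 < r. Proof. by rewrite mulr_gt0// sinh_gt0. Qed.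
(** This relation between the Euclidean and hyperbolic centres keeps the circle above the axis and
    makes the dilation field normal to it. *)
Let rc2 : c2 ^+ 2 = r ^+ 2 + b ^+ 2.
Proof.
have chE : cosh rho ^+ 2 = 1 + sinh rho ^+ 2 by have := cosh2Bsinh2 rho; lra.
by rewrite /c2 /r !(exprMn _ b) chE; ring.
Qed.
Let rc : r < c2.
Proof.
have rc2' := rc2; have b0' := b0; have r0' := r0.
have c20 : 0 < c2 by rewrite mulr_gt0// cosh_gt0.
by rewrite -(@ltr_pXn2r _ 2)// ?nnegrE ?ltW// rc2'; nra.
Qed.

Let B := box (c1 - r) (c1 + r) (c2 - r) (c2 + r).
Let BH z : B z -> HH z.
Proof. by have rc' := rc; move=> [_ /andP[h _]]; rewrite /upper_half_plane/=; lra. Qed.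

Let circleE : hcircle_param w rho = circle c1 c2 r.
Proof. by []. Qed.

Let velocityE t : velocity (hcircle_param w rho) t = (- (r * sin t), r * cos t).
Proof.
rewrite /velocity !derive1E; congr pair; apply: derive_val.
  have h : is_derive t 1 (fun t : R => c1 + r * cos t) (- (r * sin t)).
    by apply: is_derive_eq; rewrite /GRing.scale/=; ring.
  exact: h.
have h : is_derive t 1 (fun t : R => c2 + r * sin t) (r * cos t).
  by apply: is_derive_eq; rewrite /GRing.scale/=; ring.
exact: h.
Qed.

Let speedE t : hspeed (hcircle_param w rho) t = r / (circle c1 c2 r t).2.
Proof.
rewrite /hspeed velocityE circleE /= (_ : _ + _ = r ^+ 2).
  by rewrite sqrtr_sqr gtr0_norm// r0.
by rewrite sqrrN !(exprMn _ r) -mulrDr addrC cos2Dsin2 mulr1.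
Qed.

(** The circle is traced counterclockwise, so the rotation by -pi/2 yields the outward normal;
    hyperbolic length 1 is Euclidean length y. *)
Let normalE t : hnormal (hcircle_param w rho) t =
  ((circle c1 c2 r t).2 * cos t, (circle c1 c2 r t).2 * sin t).
Proof.
have rn : r != 0 by rewrite lt0r_neq0// r0.
have yn : (circle c1 c2 r t).2 != 0.
  by rewrite lt0r_neq0//; apply: BH; apply: circle_box; exact: r0.
have alg (a y k : R) : k != 0 -> y != 0 -> k * a / (k / y) = y * a.
  by move=> k0 y0; field; rewrite k0 y0.
by rewrite /hnormal speedE velocityE /= !mulNr opprK; congr pair; exact: alg.
Qed.

Let bdry (t : R) : R := (cosqnorm (psi (circle c1 c2 r t)) +
  lam^-1 * cosqnorm (cderive psi (circle c1 c2 r t)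
   ((circle c1 c2 r t).2 * cos t, (circle c1 c2 r t).2 * sin t))) *
  (r / (circle c1 c2 r t).2).

Lemma disc_boundary : hboundary_integral (hcircle_param w rho) (2 * pi) lam psi =
  (\int[mu]_(t in `[0%R, (2 * pi)%R]) (bdry t)%:E)%E.
Proof.
by apply: eq_integral => t _; rewrite speedE normalE circleE.
Qed.

Lemma disc_case :
  (harea_integral (hdisc w rho) (fun z => (2 / sinh rho) * cosqnorm (psi z))%R <=
   hboundary_integral (hcircle_param w rho) (2 * pi)%R lam psi)%E.
Proof.
have [[rr [rs [rt er]]] [ir [is_ [it ei]]]] := eigenfunction_parts eig.
have r0' := r0; have b0' := b0.
have ab : c1 - r <= c1 + r by lra.
have cd : c2 - r <= c2 + r by lra.
set rp := rpart psi in er *; set ip := ipart psi in ei *.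
set p := 'D_(e1 R) rp in er *; set q := 'D_(e2 R) rp in er *.
set p' := 'D_(e1 R) ip in ei *; set q' := 'D_(e2 R) ip in ei *.
have sh0 := sinh_gt0 rho0.
(* The identity is quadratic in psi, so the fields of the real and imaginary parts add up to one
   whose divergence contains |psi|^2. *)
pose F1 z := disc_field1 c1 b lam rp p q z + disc_field1 c1 b lam ip p' q' z.
pose F2 z := disc_field2 c1 b lam rp p q z + disc_field2 c1 b lam ip p' q' z.
pose f1 z := disc_field1_e1 c1 b lam rp p q rr rs z +
  disc_field1_e1 c1 b lam ip p' q' ir is_ z.
pose f2 z := disc_field2_e2 c1 b lam rp p q rs rt z +
  disc_field2_e2 c1 b lam ip p' q' is_ it z.
have cnt z : B z -> [/\ {for z, continuous F1}, {for z, continuous F2},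
    {for z, continuous f1} & {for z, continuous f2}].
  move=> /BH Hz; have [h1 h2 h3 h4] := disc_fields_continuous c1 b er Hz.
  have [k1 k2 k3 k4] := disc_fields_continuous c1 b ei Hz.
  by split; apply: cvgD.
have cf1 z : B z -> {for z, continuous f1} by move=> /cnt[].
have cf2 z : B z -> {for z, continuous f2} by move=> /cnt[].
have div : \int[mu2]_(z in disc c1 c2 r) (f1 z + f2 z) =
  \int[mu]_(t in `[0, 2 * pi])
    ((F1 (circle c1 c2 r t) * cos t + F2 (circle c1 c2 r t) * sin t) * r).
  apply: (disc_divergence r0).
  - move=> z /BH Hz; apply: is_deriveD; apply: is_derive_disc_field1;
      [exact: er|exact: Hz|exact: ei|exact: Hz].
  - move=> z /BH Hz; apply: is_deriveD; apply: is_derive_disc_field2;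
      [exact: er|exact: Hz|exact: ei|exact: Hz].
  - by move=> z /cnt[].
  - by move=> z /cnt[].
  - exact: cf1.
  - exact: cf2.
pose W z := (2 / sinh rho) * cosqnorm (psi z) / z.2 ^+ 2.
have cW z : B z -> {for z, continuous W}.
  move=> /BH Hz; have z0 : z.2 != 0 by exact: lt0r_neq0.
  have z2 : z.2 ^+ 2 != 0 by rewrite expf_neq0.
  have h1 : cont_at z (fun z => rp z) by exact: (ed_f er Hz).
  have h2 : cont_at z (fun z => ip z) by exact: (ed_f ei Hz).
  change (cont_at z (fun z => (2 / sinh rho) * (rp z ^+ 2 + ip z ^+ 2) / z.2 ^+ 2)).
  continuity.
pose bd t := (rp (circle c1 c2 r t) ^+ 2 + ip (circle c1 c2 r t) ^+ 2 + lam^-1 *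
  (((circle c1 c2 r t).2 * cos t * p (circle c1 c2 r t) +
    (circle c1 c2 r t).2 * sin t * q (circle c1 c2 r t)) ^+ 2 +
   ((circle c1 c2 r t).2 * cos t * p' (circle c1 c2 r t) +
    (circle c1 c2 r t).2 * sin t * q' (circle c1 c2 r t)) ^+ 2)) *
  (r / (circle c1 c2 r t).2).
have circH t : HH (circle c1 c2 r t) by apply: BH; exact: circle_box.
have bdE t : bdry t = bd t.
  rewrite /bdry /bd /cosqnorm /cderive /=; congr ((_ + _ * (_ ^+ 2 + _ ^+ 2)) * _).
    apply: (@derive_val _ _ _ _ _ _ _ (is_derive_direction _ _
      open_upper_half_plane (circH t) (ed_f1 er) (ed_f2 er)
      (ed_p er (circH t)) (ed_q er (circH t)))).
  apply: (@derive_val _ _ _ _ _ _ _ (is_derive_direction _ _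
      open_upper_half_plane (circH t) (ed_f1 ei) (ed_f2 ei)
      (ed_p ei (circH t)) (ed_q ei (circH t)))).
have cbd : continuous bd.
  move=> t.
  have ccirc (g : R * R -> R) : (forall z, HH z -> {for z, continuous g}) ->
      cont_at t (fun t => g (circle c1 c2 r t)).
    move=> cg; apply: (@continuous_comp _ _ _ (circle c1 c2 r) g).
      exact: circle_continuous.
    exact: cg.
  have h1 := ccirc _ (ed_f er); have h2 := ccirc _ (ed_f ei).
  have h3 := ccirc _ (ed_p er); have h4 := ccirc _ (ed_p ei).
  have h5 := ccirc _ (ed_q er); have h6 := ccirc _ (ed_q ei).
  have h7 : cont_at t (fun t => (circle c1 c2 r t).2).
    by apply: ccirc => z _; exact: cvg_snd.
  have h8 : cont_at t (fun t : R => cos t) by exact: continuous_cos.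
  have h9 : cont_at t (fun t : R => sin t) by exact: continuous_sin.
  have n0 : (circle c1 c2 r t).2 != 0 by apply: lt0r_neq0; exact: circH.
  change (cont_at t bd); rewrite /bd.
  continuity.
have mD := measurable_disc c1 c2 r.
have iW : mu2.-integrable (disc c1 c2 r) (EFin \o W).
  exact: (box_integrable ab cd mD (disc_box r0) cW).
have ibd : mu.-integrable `[0, 2 * pi] (EFin \o bd).
  by apply: continuous_segment_integrable => t _; exact: cbd.
have HE : hboundary_integral (hcircle_param w rho) (2 * pi) lam psi =
    (\int[mu]_(t in `[0, 2 * pi]) bd t)%:E.
  rewrite disc_boundary /Rintegral fineK; last exact: integrable_fin_num ibd.
  by apply: eq_integral => t _; rewrite bdE.
have AE : harea_integral (hdisc w rho) (fun z => (2 / sinh rho) * cosqnorm (psi z))%R =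
    (\int[mu2]_(z in disc c1 c2 r) W z)%:E.
  by rewrite hdisc_disc// /Rintegral fineK//; exact: integrable_fin_num iW.
rewrite HE AE lee_fin.
pose flux t := (F1 (circle c1 c2 r t) * cos t + F2 (circle c1 c2 r t) * sin t) * r.
have cflux : continuous flux.
  move=> t; have [k1 k2 _ _] := cnt _ (circle_box c1 c2 r0 t).
  have h1 : cont_at t (fun t => F1 (circle c1 c2 r t)).
    by apply: (@continuous_comp _ _ _ (circle c1 c2 r) F1); [exact: circle_continuous|].
  have h2 : cont_at t (fun t => F2 (circle c1 c2 r t)).
    by apply: (@continuous_comp _ _ _ (circle c1 c2 r) F2); [exact: circle_continuous|].
  have h8 : cont_at t (fun t : R => cos t) by exact: continuous_cos.
  have h9 : cont_at t (fun t : R => sin t) by exact: continuous_sin.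
  change (cont_at t flux); rewrite /flux.
  continuity.
have k0 : 0 < 2 * lam * r by apply: mulr_gt0 => //; apply: mulr_gt0.
rewrite -(ler_pM2l k0) -!RintegralZl//.
have i12 : mu2.-integrable (disc c1 c2 r) (EFin \o (fun z => f1 z + f2 z)).
  apply: (box_integrable ab cd mD (disc_box r0)) => z Bz.
  by apply: cvgD; [exact: cf1|exact: cf2].
apply: (@le_trans _ _ (\int[mu2]_(z in disc c1 c2 r) (f1 z + f2 z))).
  apply: le_Rintegral => //.
    apply: (box_integrable ab cd mD (disc_box r0)) => z Bz.
    by apply: cvgM; [exact: cvg_cst|exact: cW].
  move=> z Dz; have Hz := BH (disc_box r0 Dz).
  rewrite /f1 /f2 addrACA !(disc_divergenceE c1 b _ Hz)//.
  exact: disc_weight_le.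
rewrite div; apply: le_Rintegral => //.
- by apply: continuous_segment_integrable => t _; exact: cflux.
- apply: continuous_segment_integrable => t _.
  by apply: cvgM; [exact: cvg_cst|exact: cbd].
move=> t _; have Hz := circH t.
have cs1 : cos t ^+ 2 + sin t ^+ 2 = 1 by exact: cos2Dsin2.
have dil1E : dilation1 c1 (circle c1 c2 r t) = 2 * (circle c1 c2 r t).2 * r * cos t.
  by rewrite /dilation1 /circle/=; ring.
have dil2E : dilation2 c1 b (circle c1 c2 r t) = 2 * (circle c1 c2 r t).2 * r * sin t.
  rewrite /dilation2 /circle/=.
  (* Then y^2 - r^2 cos^2 t - c2^2 + r^2, with y = c2 + r sin t, collapses to 2 y r sin t. *)
  have -> : b ^+ 2 = c2 ^+ 2 - r ^+ 2 by rewrite rc2; ring.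
  rewrite (_ : r ^+ 2 = r ^+ 2 * (cos t ^+ 2 + sin t ^+ 2)); last by rewrite cs1 mulr1.
  by ring.
have rl : 0 <= r by exact: ltW.
have A1 := disc_flux_le lam rp p q Hz rl cs1 dil1E dil2E.
have A2 := disc_flux_le lam ip p' q' Hz rl cs1 dil1E dil2E.
exact: disc_flux_sum_le.
Qed.

End disc_case.

(** * The divergence theorem on a strip *)

Section strip.
Context {R : realType}.
Local Notation mu := (@lebesgue_measure R).
Local Notation mu2 := (@lebesgue_measure R \x @lebesgue_measure R)%E.
Local Notation R2 := (measurableTypeR R * measurableTypeR R)%type.
Local Notation HH := (@upper_half_plane R).
Implicit Types (g F f : R * R -> R) (S T y : R).

(** Half-open in x and open in y, so that the strips of growing height exhaust [cusp_strip]
    exactly. *)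
Definition strip S T : set (R * R) := [set z | 0 <= z.1 < 1 /\ S < z.2 < T].

Definition avg g y : R := \int[mu]_(x in `[0, 1]) g (x, y).

Lemma stripE S T : strip S T = `[0, 1[ `*` `]S, T[.
Proof. by apply/seteqP; split=> z [h k]; split; move: h k; rewrite /= !in_itv. Qed.

Lemma measurable_strip S T : measurable (strip S T : set R2).
Proof. by rewrite stripE; exact: measurableX. Qed.

Lemma strip_box S T : strip S T `<=` box 0 1 S T.
Proof.
move=> z [/andP[h1 h2] /andP[h3 h4]].
by split; rewrite ?h1 ?(ltW h2) ?(ltW h3) ?(ltW h4).
Qed.

Lemma box_HH a b S T z : 0 < S -> box a b S T z -> HH z.
Proof. by move=> S0 [_ /andP[h _]]; exact: lt_le_trans h. Qed.

Let le01 : (0 : R) <= 1. Proof. exact: ler01. Qed.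

Lemma strip_integrable g S T : 0 < S -> S <= T ->
  (forall z, HH z -> {for z, continuous g}) ->
  mu2.-integrable (strip S T) (EFin \o g).
Proof.
move=> S0 ST cg; apply: (box_integrable le01 ST (measurable_strip S T) (@strip_box S T)).
by move=> z /(box_HH S0); exact: cg.
Qed.

Lemma section_integrable g y : 0 < y ->
  (forall z, HH z -> {for z, continuous g}) ->
  mu.-integrable `[0, 1] (EFin \o (fun x => g (x, y))).
Proof.
move=> y0 cg; apply: continuous_segment_integrable => x _.
by apply: continuous_section1; exact: cg.
Qed.

Lemma strip_fubini g S T : 0 < S -> S <= T ->
  (forall z, HH z -> {for z, continuous g}) ->
  mu.-integrable `]S, T[ (EFin \o avg g) /\
  \int[mu2]_(z in strip S T) g z = \int[mu]_(y in `]S, T[) avg g y.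
Proof.
move=> S0 ST cg.
have cB z : box 0 1 S T z -> {for z, continuous g} by move=> /(box_HH S0); exact: cg.
have [iG ->] := box_fubini2 le01 ST (measurable_strip S T) (@strip_box S T) cB.
have sub : `]S, T[ `<=` `[S, T] by exact: subset_itv_oo_cc.
have iG' : mu.-integrable `]S, T[
    (EFin \o fun y => \int[mu]_(x in ysection (strip S T) y) g (x, y)).
  exact: integrableS iG.
have E y : y \in `]S, T[%classic ->
    \int[mu]_(x in ysection (strip S T) y) g (x, y) = avg g y.
  rewrite inE /= in_itv/= => yST.
  have -> : ysection (strip S T) y = [set` Interval (BSide true 0) (BSide true 1)].
    apply/seteqP; split=> x; rewrite /ysection/= inE /strip/= in_itv/=; first by case.
    by move=> ->.
  apply: Rintegral_bndbnd => x _; apply: continuous_section1; apply: cg.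
  by rewrite /upper_half_plane/=; lra.
split.
  by apply: eq_integrable iG' => // y yST; rewrite /= E.
transitivity (\int[mu]_(y in `]S, T[) \int[mu]_(x in ysection (strip S T) y) g (x, y)).
  have /integrableP[mG _] := iG'.
  by rewrite /Rintegral (integral_itv_bndoo true false mG).
exact: eq_Rintegral.
Qed.

(** Only the horizontal sides contribute: on the vertical ones the values of [F1] agree, so their
    fluxes cancel. *)
Lemma strip_divergence F1 F2 f1 f2 S T : 0 < S -> S <= T ->
  (forall z, HH z -> is_derive z (e1 R) F1 (f1 z)) ->
  (forall z, HH z -> is_derive z (e2 R) F2 (f2 z)) ->
  (forall z, HH z -> {for z, continuous F2}) ->
  (forall z, HH z -> {for z, continuous f1}) ->
  (forall z, HH z -> {for z, continuous f2}) ->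
  (forall y, 0 < y -> F1 (1, y) = F1 (0, y)) ->
  \int[mu2]_(z in strip S T) (f1 z + f2 z) = avg F2 T - avg F2 S.
Proof.
move=> S0 ST dF1 dF2 cF2 cf1 cf2 per.
have i1 := strip_integrable S0 ST cf1.
have i2 := strip_integrable S0 ST cf2.
have mS := measurable_strip S T.
have T0 : 0 < T by exact: lt_le_trans ST.
have BH z : box 0 1 S T z -> HH z by exact: box_HH.
rewrite RintegralD//.
have -> : \int[mu2]_(z in strip S T) f1 z = 0.
  transitivity (\int[mu]_(y in `[S, T]) (0 : R)); last by rewrite Rintegral_cst// mul0r.
  apply: (@green_ysection _ 0 1 S T (strip S T) F1 f1 le01 ST mS (@strip_box S T)
      (fun z Bz => cf1 z (BH z Bz)) (fun=> 0) (fun=> 1) (fun=> 0) false true true true).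
  - exact: cst_continuous.
  - by move=> z /BH; exact: dF1.
  - move=> y; rewrite in_itv/= => yST; split; rewrite ?lexx//.
      apply/seteqP; split=> x; rewrite /ysection/= inE /strip/= in_itv/=; first by case.
      by move=> ->.
    by rewrite per ?subrr//; lra.
have [G [cG GE _]] := box_extension le01 ST (fun z Bz => cF2 z (BH z Bz)).
have cGs y : continuous (fun x => G (x, y)).
  by move=> x; apply: continuous_section1; exact: cG.
rewrite add0r; transitivity (\int[mu]_(x in `[0, 1]) (G (x, T) - G (x, S))).
  apply: (@green_xsection _ 0 1 S T (strip S T) F2 f2 le01 ST mS (@strip_box S T)
      (fun z Bz => cf2 z (BH z Bz)) (fun=> S) (fun=> T)
      (fun x => G (x, T) - G (x, S)) true true false true).
  - by move=> x; apply: cvgB; exact: cGs.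
  - by move=> z /BH; exact: dF2.
  - move=> x; rewrite in_itv/= => x01; split; rewrite ?lexx//.
      apply/seteqP; split=> y; rewrite /xsection/= inE /strip/= in_itv/=; first by case.
      by [].
    by rewrite !GE//; split => /=; rewrite ?lexx ?ST//; lra.
rewrite RintegralB//; try by apply: continuous_segment_integrable => x _; exact: cGs.
by congr (_ - _); apply: eq_Rintegral => x; rewrite inE/= in_itv/= => x01;
  rewrite GE//; split; rewrite //= ?lexx ST.
Qed.

End strip.

(** * The Rellich field of a cusp *)

Section cusp_fields.
Context {R : realType}.
Variables (lam : R) (f p q r s t : R * R -> R).
Hypothesis ed : eigen_data lam f p q r s t.
Local Notation HH := (@upper_half_plane R).

(** For X = - d/dy the field F is (- 2 p q, p^2 - q^2 - lambda f^2 / y^2). Its two components are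
    differentiated here and in [is_derive_cusp_flux2]; in the sum only 2 lambda f^2 / y^3
    survives. *)
Lemma is_derive_cusp_flux1 z : HH z ->
  is_derive z (e1 R) (fun z => - (2 * (p z * q z)))
    (- (2 * (r z * q z + p z * s z))).
Proof.
move=> Hz; have := ed_p1 ed Hz; have := ed_q1 ed Hz => d1 d2.
by apply: is_derive_eq; rewrite /GRing.scale/=; ring.
Qed.

Lemma is_derive_cusp_flux2 z : HH z ->
  is_derive z (e2 R) (fun z => p z ^+ 2 - q z ^+ 2 - lam * (f z ^+ 2 * z.2^-1 ^+ 2))
    (2 * (r z * q z + p z * s z) + 2 * lam * f z ^+ 2 / z.2 ^+ 3).
Proof.
move=> Hz; have z0 : z.2 != 0 by exact: lt0r_neq0.
have := ed_f2 ed Hz; have := ed_p2 ed Hz; have := ed_q2 ed Hz.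
have := is_derive_inv_snd (e2 R) z0 => d1 d2 d3 d4.
apply: is_derive_eq; rewrite /GRing.scale/=.
have -> : r z = - (lam * f z) / z.2 ^+ 2 - t z by rewrite -(ed_eq ed Hz) addrK.
move: (f z) (p z) (q z) (s z) (t z) (z.2) z0 => F P Q S T y y0.
by field.
Qed.

(** The field 2 f grad f is the gradient of f^2; its divergence 2 |grad f|^2 - 2 lambda f^2 / y^2
    yields the second derivative of the mean of f^2. *)
Lemma is_derive_grad1 z : HH z ->
  is_derive z (e1 R) (fun z => 2 * (f z * p z)) (2 * (p z ^+ 2 + f z * r z)).
Proof.
move=> Hz; have := ed_p1 ed Hz; have := ed_f1 ed Hz => d1 d2.
by apply: is_derive_eq; rewrite /GRing.scale/=; ring.
Qed.

Lemma is_derive_grad2 z : HH z ->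
  is_derive z (e2 R) (fun z => 2 * (f z * q z))
    (2 * q z ^+ 2 - 2 * (lam * f z ^+ 2 / z.2 ^+ 2) - 2 * (f z * r z)).
Proof.
move=> Hz; have z0 : z.2 != 0 by exact: lt0r_neq0.
have := ed_q2 ed Hz; have := ed_f2 ed Hz => d1 d2.
apply: is_derive_eq; rewrite /GRing.scale/=.
have -> : r z = - (lam * f z) / z.2 ^+ 2 - t z by rewrite -(ed_eq ed Hz) addrK.
move: (f z) (p z) (q z) (s z) (t z) (z.2) z0 => F P Q S T y y0.
by field.
Qed.

Lemma is_derive_sqr2 z : HH z ->
  is_derive z (e2 R) (fun z => f z ^+ 2) (2 * (f z * q z)).
Proof.
move=> Hz; have := ed_f2 ed Hz => d1.
by apply: is_derive_eq; rewrite /GRing.scale/=; ring.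
Qed.

End cusp_fields.

Section cusp_case.
Context {R : realType}.
Local Notation mu := (@lebesgue_measure R).
Local Notation mu2 := (@lebesgue_measure R \x @lebesgue_measure R)%E.
Local Notation R2 := (measurableTypeR R * measurableTypeR R)%type.
Local Notation HH := (@upper_half_plane R).

(** Translation commutes with differentiation; as the half-plane is open, periodicity holds near
    [z], which suffices for derivatives. *)
Lemma derive_periodic (f : R * R -> R) (v z : R * R) :
  (forall z, HH z -> f (z.1 + 1, z.2) = f z) -> HH z ->
  'D_v f (z.1 + 1, z.2) = 'D_v f z.
Proof.
move=> per Hz.
transitivity ('D_v (fun u : R * R => f (u.1 + 1, u.2)) z).
  have q : (fun h : R => h^-1 *: ((f \o shift (z.1 + 1, z.2)) (h *: v) -
      f (z.1 + 1, z.2))) =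
      (fun h : R => h^-1 *: (((fun u : R * R => f (u.1 + 1, u.2)) \o shift z) (h *: v) -
      f (z.1 + 1, z.2))).
    by apply/funext => h; rewrite /= -addrA.
  by rewrite /derive q.
apply: near_eq_derive; have := open_nbhs_nbhs (conj open_upper_half_plane Hz).
by apply: filterS => u; exact: per.
Qed.

Variables (lam Y : R) (f p q r s t g p' q' r' s' t' : R * R -> R).
Hypotheses (lam0 : 0 < lam) (Y0 : 0 < Y).
Hypothesis edf : eigen_data lam f p q r s t.
Hypothesis edg : eigen_data lam g p' q' r' s' t'.

(** With [f] and [g] the real and imaginary parts, [E] is |psi|^2, [M] its vertical derivative and
    [V] its Euclidean Laplacian, so that the period integrals of [M] and [V] are the first two
    derivatives of that of [E]. [G] is minus the vertical component of the cusp field and [N] the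
    divergence of that field. The link between them is [V = 4 Q - 2 G]. *)
Let E z := f z ^+ 2 + g z ^+ 2.
Let Q z := q z ^+ 2 + q' z ^+ 2.
Let P z := p z ^+ 2 + p' z ^+ 2.
Let M z := 2 * (f z * q z) + 2 * (g z * q' z).
Let G z := Q z - P z + lam * (E z / z.2 ^+ 2).
Let V z := 2 * P z + 2 * Q z - 2 * (lam * (E z / z.2 ^+ 2)).
Let N z := 2 * lam * E z / z.2 ^+ 3.

Hypothesis per : forall y, 0 < y ->
  [/\ f (1, y) = f (0, y), p (1, y) = p (0, y), q (1, y) = q (0, y),
     g (1, y) = g (0, y) & p' (1, y) = p' (0, y)] /\ q' (1, y) = q' (0, y).

Ltac cont_HH z Hz :=
  (have z0 : z.2 != 0 by exact: lt0r_neq0);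
  (have cf : cont_at z (fun z => f z) by exact: (ed_f edf Hz));
  (have cp : cont_at z (fun z => p z) by exact: (ed_p edf Hz));
  (have cq : cont_at z (fun z => q z) by exact: (ed_q edf Hz));
  (have cr : cont_at z (fun z => r z) by exact: (ed_r edf Hz));
  (have cs : cont_at z (fun z => s z) by exact: (ed_s edf Hz));
  (have cg : cont_at z (fun z => g z) by exact: (ed_f edg Hz));
  (have cp' : cont_at z (fun z => p' z) by exact: (ed_p edg Hz));
  (have cq' : cont_at z (fun z => q' z) by exact: (ed_q edg Hz));
  (have cr' : cont_at z (fun z => r' z) by exact: (ed_r edg Hz));
  (have cs' : cont_at z (fun z => s' z) by exact: (ed_s edg Hz));
  (have cz2 : z.2 ^+ 2 != 0 by rewrite expf_neq0);
  (have cz3 : z.2 ^+ 3 != 0 by rewrite expf_neq0).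

Let cE z : HH z -> cont_at z E.
Proof. by move=> Hz; cont_HH z Hz; rewrite /E; continuity. Qed.
Let cM z : HH z -> cont_at z M.
Proof. by move=> Hz; cont_HH z Hz; rewrite /M; continuity. Qed.
Let cG z : HH z -> cont_at z G.
Proof. by move=> Hz; cont_HH z Hz; rewrite /G /Q /P /E; continuity. Qed.
Let cV z : HH z -> cont_at z V.
Proof. by move=> Hz; cont_HH z Hz; rewrite /V /Q /P /E; continuity. Qed.
Let cN z : HH z -> cont_at z N.
Proof. by move=> Hz; cont_HH z Hz; rewrite /N /E; continuity. Qed.

Let divE S T : 0 < S -> S <= T ->
  \int[mu2]_(z in strip S T) M z = avg E T - avg E S.
Proof.
move=> S0 ST; transitivity (\int[mu2]_(z in strip S T) (0 + M z)).
  by apply: eq_Rintegral => z _; rewrite add0r.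
apply: (@strip_divergence _ (fun=> 0) E (fun=> 0) M S T S0 ST).
- by move=> z Hz; apply: is_deriveD;
    [exact: (is_derive_sqr2 edf Hz)|exact: (is_derive_sqr2 edg Hz)].
- exact: cE.
- by move=> z _; exact: cvg_cst.
- exact: cM.
- by [].
Qed.

Let divM S T : 0 < S -> S <= T ->
  \int[mu2]_(z in strip S T) V z = avg M T - avg M S.
Proof.
move=> S0 ST.
pose F1 z := 2 * (f z * p z) + 2 * (g z * p' z).
pose f1 z := 2 * (p z ^+ 2 + f z * r z) + 2 * (p' z ^+ 2 + g z * r' z).
pose f2 z := (2 * q z ^+ 2 - 2 * (lam * f z ^+ 2 / z.2 ^+ 2) - 2 * (f z * r z)) +
  (2 * q' z ^+ 2 - 2 * (lam * g z ^+ 2 / z.2 ^+ 2) - 2 * (g z * r' z)).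
transitivity (\int[mu2]_(z in strip S T) (f1 z + f2 z)).
  by apply: eq_Rintegral => z _; rewrite /V /f1 /f2 /P /Q /E; ring.
apply: (@strip_divergence _ F1 M f1 f2 S T S0 ST).
- by move=> z Hz; apply: is_deriveD;
    [exact: (is_derive_grad1 edf Hz)|exact: (is_derive_grad1 edg Hz)].
- by move=> z Hz; apply: is_deriveD;
    [exact: (is_derive_grad2 edf Hz)|exact: (is_derive_grad2 edg Hz)].
- exact: cM.
- by move=> z Hz; cont_HH z Hz; change (cont_at z f1); rewrite /f1; continuity.
- by move=> z Hz; cont_HH z Hz; change (cont_at z f2); rewrite /f2; continuity.
- by move=> y /per[[E1 E2 E3 E4 E5] E6]; rewrite /F1 E1 E2 E4 E5.
Qed.

Let divG S T : 0 < S -> S <= T ->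
  \int[mu2]_(z in strip S T) N z = avg G S - avg G T.
Proof.
move=> S0 ST.
pose F1 z := - (2 * (p z * q z)) + - (2 * (p' z * q' z)).
pose F2 z := (p z ^+ 2 - q z ^+ 2 - lam * (f z ^+ 2 * z.2^-1 ^+ 2)) +
  (p' z ^+ 2 - q' z ^+ 2 - lam * (g z ^+ 2 * z.2^-1 ^+ 2)).
pose f1 z := - (2 * (r z * q z + p z * s z)) + - (2 * (r' z * q' z + p' z * s' z)).
pose f2 z := (2 * (r z * q z + p z * s z) + 2 * lam * f z ^+ 2 / z.2 ^+ 3) +
  (2 * (r' z * q' z + p' z * s' z) + 2 * lam * g z ^+ 2 / z.2 ^+ 3).
have F2E z : F2 z = - G z by rewrite /F2 /G /Q /P /E exprVn; ring.
have aF y : 0 < y -> avg F2 y = - avg G y.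
  move=> y0; rewrite -mulN1r -RintegralZl//; last exact: (section_integrable y0 cG).
  by apply: eq_Rintegral => x _; rewrite F2E mulN1r.
have T0 : 0 < T by exact: lt_le_trans ST.
transitivity (avg F2 T - avg F2 S); last by rewrite !aF//; ring.
transitivity (\int[mu2]_(z in strip S T) (f1 z + f2 z)).
  by apply: eq_Rintegral => z _; rewrite /N /f1 /f2 /E; ring.
apply: (@strip_divergence _ F1 F2 f1 f2 S T S0 ST).
- by move=> z Hz; apply: is_deriveD;
    [exact: (is_derive_cusp_flux1 edf Hz)|exact: (is_derive_cusp_flux1 edg Hz)].
- by move=> z Hz; apply: is_deriveD;
    [exact: (is_derive_cusp_flux2 edf Hz)|exact: (is_derive_cusp_flux2 edg Hz)].
- by move=> z Hz; cont_HH z Hz; change (cont_at z F2); rewrite /F2; continuity.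
- by move=> z Hz; cont_HH z Hz; change (cont_at z f1); rewrite /f1; continuity.
- by move=> z Hz; cont_HH z Hz; change (cont_at z f2); rewrite /f2; continuity.
- by move=> y /per[[E1 E2 E3 E4 E5] E6]; rewrite /F1 E2 E3 E5 E6.
Qed.

Let affine_integral (al be S T : R) : S <= T ->
  mu.-integrable `]S, T[ (EFin \o (fun y => al + be * (y - S))) /\
  \int[mu]_(y in `]S, T[) (al + be * (y - S)) =
    al * (T - S) + be / 2 * (T - S) ^+ 2.
Proof.
move=> ST.
have ca y : cont_at y (fun y : R => al + be * (y - S)).
  have cid : cont_at y (fun y : R => y) by exact: cvg_id.
  continuity.
split.
  apply: (@integrableS _ _ _ mu `[S, T]) => //; first exact: subset_itv_oo_cc.
  by apply: continuous_segment_integrable => y _; exact: ca.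
rewrite (@Rintegral_bndbnd _ _ S T false true) => [|y _]; last exact: ca.
transitivity ((al * (T - S) + be / 2 * (T - S) ^+ 2) -
    (al * (S - S) + be / 2 * (S - S) ^+ 2)).
  apply: (FTC_segment (F := fun y : R => al * (y - S) + be / 2 * (y - S) ^+ 2)) => // y _.
    exact: ca.
  by apply: is_derive_eq; rewrite /GRing.scale/=; field.
by rewrite subrr expr2; ring.
Qed.

Lemma cusp_flux_nincr S T : 0 < S -> S <= T -> avg G T <= avg G S.
Proof.
move=> S0 ST; rewrite -subr_ge0 -divG//.
apply: Rintegral_ge0 => z [_ /andP[Sz _]].
have z0 : 0 < z.2 by exact: lt_trans Sz.
by rewrite /N /E divr_ge0 ?exprn_ge0 ?(ltW z0)// !mulr_ge0 ?addr_ge0 ?sqr_ge0// ltW.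
Qed.

(* If the flux were negative somewhere, [avg E] would be at least quadratic,
   and [avg E y / y^2] would not be integrable. *)
Lemma cusp_flux_ge0 (K T0 : R) :
  (forall S T, Y <= S -> S <= T ->
    \int[mu2]_(z in strip S T) (E z / z.2 ^+ 2) <= K) ->
  Y <= T0 -> 0 <= avg G T0.
Proof.
move=> L2 YT0; rewrite leNgt; apply/negP => GT0.
pose c := - avg G T0; have c0 : 0 < c by rewrite oppr_gt0.
have T00 : 0 < T0 by exact: lt_le_trans YT0.
(* From [V = 4 Q - 2 G >= - 2 G] and the monotonicity of the flux; two integrations then give [M_ge]
   and [E_ge]. *)
have V_ge y : T0 <= y -> 2 * c <= avg V y.
  move=> Ty; have y0 : 0 < y by exact: lt_le_trans Ty.
  apply: (@le_trans _ _ (-2 * avg G y)).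
    by have := cusp_flux_nincr T00 Ty; rewrite /c; lra.
  rewrite -RintegralZl//; last exact: (section_integrable y0 cG).
  apply: le_Rintegral => //.
  - apply: continuous_segment_integrable => x _.
    apply: cvgM; first exact: cvg_cst.
    by apply: (continuous_section1 (F := G)); exact: cG.
  - exact: (section_integrable y0 cV).
  - move=> x _; rewrite /V /G; have : 0 <= Q (x, y) by rewrite /Q addr_ge0 ?sqr_ge0.
    by move: (Q (x, y)) (P (x, y)) (_ * (_ / _)) => u v w; lra.
have M_ge T : T0 <= T -> avg M T0 + 2 * c * (T - T0) <= avg M T.
  move=> TT; rewrite addrC -lerBrDr -divM//.
  have [iV ->] := strip_fubini T00 TT cV.
  have [ia aE] := affine_integral (2 * c) 0 TT.
  rewrite (_ : 2 * c * (T - T0) = 2 * c * (T - T0) + 0 / 2 * (T - T0) ^+ 2); last by ring.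
  rewrite -aE; apply: le_Rintegral => // y.
  rewrite /= in_itv/= => /andP[Ty _]; rewrite mul0r addr0; exact/V_ge/ltW.
have E_ge T : T0 <= T -> avg M T0 * (T - T0) + c * (T - T0) ^+ 2 <= avg E T.
  move=> TT.
  have E0 : 0 <= avg E T0.
    by apply: Rintegral_ge0 => x _; rewrite /E addr_ge0 ?sqr_ge0.
  suff : avg M T0 * (T - T0) + c * (T - T0) ^+ 2 <= avg E T - avg E T0 by lra.
  rewrite -divE//.
  have [iM ->] := strip_fubini T00 TT cM.
  have [ia aE] := affine_integral (avg M T0) (2 * c) TT.
  rewrite (_ : c * (T - T0) ^+ 2 = (2 * c) / 2 * (T - T0) ^+ 2); last by field.
  rewrite -aE; apply: le_Rintegral => // y.
  by rewrite /= in_itv/= => /andP[Ty _]; exact/M_ge/ltW.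
pose m0 := avg M T0.
(* Beyond [T1] the distance x = T - T0 satisfies c x >= 2 |m0|, so the linear term costs at most
   half of c x^2, and T <= 2 x turns c x^2 / 2 into c T^2 / 8. *)
pose T1 := T0 + (T0 + 2 * `|m0| / c).
have mc : 0 <= 2 * `|m0| / c by rewrite divr_ge0 ?(ltW c0)// mulr_ge0.
have T1T0 : T0 <= T1 by rewrite /T1; lra.
have T10 : 0 < T1 by exact: lt_le_trans T1T0.
have E_ge2 T : T1 <= T -> c / 8 * T ^+ 2 <= avg E T.
  move=> TT1; apply: le_trans (E_ge T (le_trans T1T0 TT1)).
  have s1 : T0 <= T - T0 by move: TT1; rewrite /T1; lra.
  have s2 : 2 * `|m0| / c <= T - T0 by move: TT1; rewrite /T1; lra.
  move: s2; rewrite ler_pdivrMr// => s2.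
  have := ler_norm (- m0); rewrite normrN -/m0 => m0n.
  rewrite -(subrK T0 T); move: (T - T0) s1 s2 => x s1 s2.
  rewrite addrK.
  have x0 : 0 < x by lra.
  have h1 : 0 <= x * (m0 + x * c / 2) by apply: mulr_ge0; lra.
  have h2 : 0 <= c / 8 * ((2 * x) ^+ 2 - (x + T0) ^+ 2).
    by apply: mulr_ge0; [lra|nra].
  nra.
(* The integrand [avg E y / y^2] is at least c / 8 above [T1], so this height makes its integral at
   least |K| + 1. *)
pose T := T1 + 8 * (`|K| + 1) / c.
have K0 : 0 <= 8 * (`|K| + 1) / c by rewrite divr_ge0 ?(ltW c0)// mulr_ge0// addr_ge0.
have T1T : T1 <= T by rewrite /T; lra.
have := L2 T1 T (le_trans YT0 T1T0) T1T; apply/negP; rewrite -ltNge.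
pose g2 z := E z / z.2 ^+ 2.
have cg2 z : HH z -> cont_at z g2.
  by move=> Hz; cont_HH z Hz; rewrite /g2 /E; continuity.
have [ig ->] := strip_fubini T10 T1T cg2.
have [ia aE] := affine_integral (c / 8) 0 T1T.
apply: (@lt_le_trans _ _ (c / 8 * (T - T1) + 0 / 2 * (T - T1) ^+ 2)).
  rewrite mul0r mul0r addr0 /T addrAC subrr add0r (_ : c / 8 * _ = `|K| + 1).
    by have := ler_norm K; lra.
  by field; rewrite lt0r_neq0.
rewrite -aE; apply: le_Rintegral => // y.
rewrite /= in_itv/= => /andP[Ty _]; rewrite mul0r addr0.
have y0 : 0 < y by exact: lt_trans Ty.
have -> : avg g2 y = avg E y / y ^+ 2.
  by rewrite -RintegralZr//; exact: (section_integrable y0 cE).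
by rewrite ler_pdivlMr ?exprn_gt0//; exact/E_ge2/ltW.
Qed.

Lemma cusp_strip_le (K T : R) :
  (forall S T, Y <= S -> S <= T ->
    \int[mu2]_(z in strip S T) (E z / z.2 ^+ 2) <= K) ->
  Y <= T -> \int[mu2]_(z in strip Y T) N z <= avg G Y.
Proof.
by move=> L2 YT; rewrite divG//; have := cusp_flux_ge0 L2 YT; lra.
Qed.

End cusp_case.

(** * Smoothness of the weights *)

Section smooth_weights.
Context {R : realType}.

Lemma smooth_on_cst (U : set (R * R)) (c : R) : smooth_on U (fun=> c).
Proof.
move=> k; elim: k c => [|k IH] c; split=> //; try by move=> z _; exact: cvg_cst.
have E v : 'D_v (fun=> c) = (fun=> 0) :> (R * R -> R).
  by apply/funext => z; exact: derive_cst.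
split; try by rewrite E; exact: IH.
by move=> z _; split; exact: derivable_cst.
Qed.

(** Differentiation gives 0 or changes the sign of [c], so the induction on the order runs with [c]
    generalized. *)
Lemma smooth_on_expRN_snd (U : set (R * R)) (c : R) :
  smooth_on U (fun z => c * expR (- z.2)).
Proof.
have cts (k : R) : continuous (fun z : R * R => k * expR (- z.2)).
  move=> z; apply: cvgM; first exact: cvg_cst.
  apply: (@continuous_comp _ _ _ (fun z : R * R => - z.2) expR);
      last exact: continuous_expR.
  by apply: cvgN; exact: cvg_snd.
have d1 (k : R) (z : R * R) : is_derive z (e1 R) (fun z : R * R => k * expR (- z.2)) 0.
  by case: z => x y; apply/is_derive_e1P; exact: (is_derive_cst (k * expR (- y)) x 1).
have d2 (k : R) (z : R * R) :
    is_derive z (e2 R) (fun z : R * R => k * expR (- z.2)) (- k * expR (- z.2)).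
  case: z => x y; apply/is_derive_e2P => /=.
  have h : is_derive y 1 (expR \o -%R) (expR (- y) * - 1).
    by apply: is_derive1_comp; exact: is_deriveNid.
  have := is_deriveM (is_derive_cst (k : R) y 1) h.
  by move/is_derive_eq; apply; rewrite /GRing.scale/=; ring.
move=> k; elim: k c => [|k IH] c; split=> //; try by move=> z _; exact: cts.
have E1 : 'D_(e1 R) (fun z : R * R => c * expR (- z.2)) = (fun=> 0).
  by apply/funext => z; apply: derive_val.
have E2 : 'D_(e2 R) (fun z : R * R => c * expR (- z.2)) = (fun z => - c * expR (- z.2)).
  by apply/funext => z; apply: derive_val.
split; [|rewrite E1; exact: smooth_on_cst|rewrite E2; exact: IH].
by move=> z _; split; [have [] := d1 c z|have [] := d2 c z].
Qed.

End smooth_weights.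

(** * The inequality for a cusp *)

Section cusp_theorem.
Context {R : realType}.
Local Notation mu := (@lebesgue_measure R).
Local Notation mu2 := (@lebesgue_measure R \x @lebesgue_measure R)%E.
Local Notation R2 := (measurableTypeR R * measurableTypeR R)%type.
Local Notation HH := (@upper_half_plane R).

Let horocycle_speed (Y t : R) : 0 < Y -> hspeed (horocycle_param Y) t = Y^-1.
Proof.
move=> Y0; rewrite /hspeed /velocity /horocycle_param /= derive1_id derive1_cst.
by rewrite expr1n expr0n addr0 sqrtr1 div1r.
Qed.

Let horocycle_normal (Y t : R) : 0 < Y -> hnormal (horocycle_param Y) t = (0, - Y).
Proof.
move=> Y0; rewrite /hnormal horocycle_speed// /velocity /horocycle_param /=.
by rewrite derive1_id derive1_cst mul0r invrK mul1r.
Qed.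

Let cusp_stripE (Y : R) : cusp_strip Y = \bigcup_n strip Y (Y + n%:R).
Proof.
apply/seteqP; split=> z; last by move=> [n _ [h1 /andP[h2 _]]].
move=> [h1 h2]; exists (Num.truncn (z.2 - Y)).+1 => //; split=> //.
by rewrite h2/= -ltrBlDl truncnS_gt.
Qed.

Lemma cusp_case (Y lam : R) (psi : R * R -> R[i]) : 0 < Y -> 0 < lam ->
  eigenfunction_cylinder lam psi -> hL2 (cusp_strip Y) psi ->
  (harea_integral (cusp_strip Y)
     (fun z => (2 * Y) * expR (- z.2) * cosqnorm (psi z))%R <=
   hboundary_integral (horocycle_param Y) 1%R lam psi)%E.
Proof.
move=> Y0 lam0 [per eig] L2.
have [[r [s [t ef]]] [r' [s' [t' eg]]]] := eigenfunction_parts eig.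
set f := rpart psi in ef *; set g := ipart psi in eg *.
set p := 'D_(e1 R) f in ef *; set q := 'D_(e2 R) f in ef *.
set p' := 'D_(e1 R) g in eg *; set q' := 'D_(e2 R) g in eg *.
have perf z : HH z -> f (z.1 + 1, z.2) = f z by move=> /per; rewrite /f /rpart => ->.
have perg z : HH z -> g (z.1 + 1, z.2) = g z by move=> /per; rewrite /g /ipart => ->.
have shift (h : R * R -> R) : (forall z, HH z -> h (z.1 + 1, z.2) = h z) ->
    forall y, 0 < y -> h (1, y) = h (0, y).
  by move=> hp y y0; rewrite -(hp (0, y))//= add0r.
have perE y : 0 < y ->
    [/\ f (1, y) = f (0, y), p (1, y) = p (0, y), q (1, y) = q (0, y),
       g (1, y) = g (0, y) & p' (1, y) = p' (0, y)] /\ q' (1, y) = q' (0, y).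
  move=> y0; split; first split; apply: shift y0 => // z Hz; exact: derive_periodic.
pose E z := f z ^+ 2 + g z ^+ 2.
pose Q z := q z ^+ 2 + q' z ^+ 2.
pose P z := p z ^+ 2 + p' z ^+ 2.
pose G z := Q z - P z + lam * (E z / z.2 ^+ 2).
pose N z := 2 * lam * E z / z.2 ^+ 3.
pose W z := 2 * Y * expR (- z.2) * E z / z.2 ^+ 2.
have cf z : HH z -> cont_at z (fun z => f z) by move=> Hz; exact: (ed_f ef Hz).
have cg z : HH z -> cont_at z (fun z => g z) by move=> Hz; exact: (ed_f eg Hz).
have cp z : HH z -> cont_at z (fun z => p z) by move=> Hz; exact: (ed_p ef Hz).
have cq z : HH z -> cont_at z (fun z => q z) by move=> Hz; exact: (ed_q ef Hz).
have cp' z : HH z -> cont_at z (fun z => p' z) by move=> Hz; exact: (ed_p eg Hz).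
have cq' z : HH z -> cont_at z (fun z => q' z) by move=> Hz; exact: (ed_q eg Hz).
have yn z n : HH z -> z.2 ^+ n != 0.
  by move=> Hz; rewrite expf_neq0//; exact: lt0r_neq0.
have cD z : HH z -> cont_at z (fun z => E z / z.2 ^+ 2).
  move=> Hz; have := yn z 2 Hz; have := cf z Hz; have := cg z Hz => ? ? ?.
  by rewrite /E; continuity.
have cN z : HH z -> cont_at z N.
  move=> Hz; have := yn z 3 Hz; have := cf z Hz; have := cg z Hz => ? ? ?.
  by rewrite /N /E; continuity.
have cG z : HH z -> cont_at z G.
  move=> Hz; have := yn z 2 Hz; have := cf z Hz; have := cg z Hz => ? ? ?.
  have := cp z Hz; have := cq z Hz; have := cp' z Hz; have := cq' z Hz => ? ? ? ?.
  by rewrite /G /Q /P /E; continuity.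
have cW z : HH z -> cont_at z W.
  move=> Hz; have := yn z 2 Hz; have := cf z Hz; have := cg z Hz => ? ? ?.
  have ce : cont_at z (fun z : R * R => expR (- z.2)).
    apply: (@continuous_comp _ _ _ (fun z : R * R => - z.2) expR);
      last exact: continuous_expR.
    by apply: cvgN; exact: cvg_snd.
  by rewrite /W /E; continuity.
have mcusp : measurable (cusp_strip Y : set R2).
  by rewrite cusp_stripE; apply: bigcup_measurable => n _; exact: measurable_strip.
have mfun (h : R * R -> R) (D : set (R * R)) : (forall z, HH z -> cont_at z h) ->
    measurable (D : set R2) -> D `<=` HH -> measurable_fun (D : set R2) (EFin \o h).
  move=> ch mD DH; apply/measurable_EFinP.
  have mh := open_continuous_measurable_fun2 open_upper_half_plane ch.
  have mH : measurable (HH : set R2).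
    by apply: open_measurable2; exact: open_upper_half_plane.
  exact: (measurable_funS mH DH mh).
have stripH S T : Y <= S -> strip S T `<=` HH.
  by move=> YS z [_ /andP[h _]]; apply: lt_trans h; exact: lt_le_trans YS.
have cuspH : cusp_strip Y `<=` HH by move=> z [_ h]; exact: lt_trans h.
(* By [L2] the integral is finite, so [fine] returns its true value; it bounds the integral over
   every truncated strip. *)
pose K := fine (harea_integral (cusp_strip Y) (fun z => cosqnorm (psi z))).
have E0 z : 0 <= E z by rewrite addr_ge0 ?sqr_ge0.
have L2' S T : Y <= S -> S <= T ->
    \int[mu2]_(z in strip S T) (E z / z.2 ^+ 2) <= K.
  move=> YS ST; have S0 : 0 < S by exact: lt_le_trans YS.
  have iD := strip_integrable S0 ST cD.
  have D0 z : (0 <= (E z / z.2 ^+ 2)%:E)%E by rewrite lee_fin divr_ge0 ?sqr_ge0.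
  apply: fine_le.
  - by apply: integrable_fin_num iD; exact: measurable_strip.
  - rewrite ge0_fin_numE; first exact: L2.
    by apply: integral_ge0 => z _; exact: D0.
  - apply: ge0_subset_integral => //.
    + exact: measurable_strip.
    + exact: (mfun _ _ cD mcusp cuspH).
    + by move=> z [h1 /andP[h2 _]]; split=> //; exact: le_lt_trans h2.
pose bd x := (E (x, Y) + lam^-1 * ((Y * q (x, Y)) ^+ 2 + (Y * q' (x, Y)) ^+ 2)) * Y^-1.
have HY x : HH (x, Y) by [].
have ibd : mu.-integrable `[0, 1] (EFin \o bd).
  apply: continuous_segment_integrable => x _.
  have h1 : cont_at x (fun x => f (x, Y)).
    by apply: (continuous_section1 (F := f)); exact: cf.
  have h2 : cont_at x (fun x => g (x, Y)).
    by apply: (continuous_section1 (F := g)); exact: cg.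
  have h3 : cont_at x (fun x => q (x, Y)).
    by apply: (continuous_section1 (F := q)); exact: cq.
  have h4 : cont_at x (fun x => q' (x, Y)).
    by apply: (continuous_section1 (F := q')); exact: cq'.
  by change (cont_at x bd); rewrite /bd /E; continuity.
have HE : hboundary_integral (horocycle_param Y) 1 lam psi =
    (\int[mu]_(x in `[0, 1]) bd x)%:E.
  rewrite /Rintegral fineK; last exact: integrable_fin_num ibd.
  apply: eq_integral => x _; congr EFin.
  rewrite horocycle_speed// horocycle_normal// /bd /cosqnorm /cderive /horocycle_param /=.
  congr ((_ + _ * (_ + _)) * _).
    rewrite (@derive_val _ _ _ _ _ _ _ (is_derive_direction 0 (- Y) open_upper_half_plane
      (HY x) (ed_f1 ef) (ed_f2 ef) (ed_p ef (HY x)) (ed_q ef (HY x)))).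
    by rewrite mul0r add0r mulNr sqrrN.
  rewrite (@derive_val _ _ _ _ _ _ _ (is_derive_direction 0 (- Y) open_upper_half_plane
    (HY x) (ed_f1 eg) (ed_f2 eg) (ed_p eg (HY x)) (ed_q eg (HY x)))).
  by rewrite mul0r add0r mulNr sqrrN.
have Yl : 0 < Y / lam by rewrite divr_gt0.
(* Multiplied by Y / lambda, the flux density [G] falls short of the boundary integrand by the
   tangential term Y / lambda [P]. *)
have bd_ge : Y / lam * avg G Y <= \int[mu]_(x in `[0, 1]) bd x.
  rewrite -RintegralZl//; last exact: (section_integrable Y0 cG).
  apply: le_Rintegral => //.
    apply: continuous_segment_integrable => x _; apply: cvgM; first exact: cvg_cst.
    by apply: (continuous_section1 (F := G)); exact: cG.
  move=> x _; rewrite /bd /G /=.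
  have P0 : 0 <= P (x, Y) by rewrite addr_ge0 ?sqr_ge0.
  rewrite -subr_ge0 (_ : _ - _ = Y / lam * P (x, Y)); first by rewrite mulr_ge0// ltW.
  by rewrite /Q; field; rewrite !lt0r_neq0.
have W_le T : Y <= T -> \int[mu2]_(z in strip Y T) W z <= \int[mu]_(x in `[0, 1]) bd x.
  move=> YT; apply: le_trans bd_ge.
  have h := cusp_strip_le lam0 Y0 ef eg perE L2' YT.
  apply: (@le_trans _ _ (Y / lam * \int[mu2]_(z in strip Y T) N z)); last first.
    by rewrite ler_pM2l.
  rewrite -RintegralZl//; [|exact: measurable_strip|exact: strip_integrable].
  apply: le_Rintegral.
  - exact: measurable_strip.
  - exact: strip_integrable.
  - by apply: strip_integrable => // z Hz; apply: cvgM; [exact: cvg_cst|exact: cN].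
  move=> z [_ /andP[Yz _]]; have z0 : 0 < z.2 by exact: lt_trans Yz.
  (* This replaces the weight 2 Y / y, which the divergence supplies, by the smaller 2 Y exp(-
     y). *)
  have ez : z.2 * expR (- z.2) <= 1.
    rewrite expRN ler_pdivrMr ?expR_gt0// mul1r.
    by apply: le_trans (expR_ge1Dx _); lra.
  rewrite -subr_ge0 (_ : _ - _ = 2 * Y * E z * (1 - z.2 * expR (- z.2)) / z.2 ^+ 3).
    rewrite divr_ge0 ?exprn_ge0 ?(ltW z0)// mulr_ge0//; last by lra.
    by rewrite !mulr_ge0// ltW.
  rewrite /N /W; move: (E z) (expR _) => e x; field.
  by rewrite !lt0r_neq0.
rewrite HE cusp_stripE /harea_integral.
have mW n : measurable_fun (strip Y (Y + n%:R) : set R2) (EFin \o W).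
  by apply: mfun => //; [exact: measurable_strip|exact: stripH].
have W0 z : HH z -> (0 <= (W z)%:E)%E.
  move=> Hz; rewrite lee_fin divr_ge0 ?sqr_ge0// !mulr_ge0// ?expR_ge0//; exact: ltW.
(* Monotone convergence along the strips of height n; the bound [W_le] does not depend on the height
   and passes to the limit. *)
have cvgW := @ge0_nondecreasing_set_cvg_integral _ _ R
  (fun n => strip Y (Y + n%:R) : set R2) (EFin \o W) mu2.
have nd : nondecreasing_seq (fun n => strip Y (Y + n%:R) : set R2).
  move=> n m nm; rewrite subsetEset => z [h1 /andP[h2 h3]]; split=> //.
  by rewrite h2/= (lt_le_trans h3)// lerD2l ler_nat.
have {}cvgW := cvgW nd (fun n => measurable_strip Y (Y + n%:R)) mW
  (fun n z Dz => W0 z (stripH Y _ (lexx Y) z Dz)).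
rewrite -(cvg_lim _ cvgW)//; apply: lime_le; first by apply/cvg_ex; eexists; exact: cvgW.
apply: nearW => n.
have YT : Y <= Y + n%:R by rewrite lerDl.
have iW := strip_integrable Y0 YT cW.
rewrite -(fineK (integrable_fin_num _ iW)); last exact: measurable_strip.
by rewrite lee_fin; exact: W_le.
Qed.

End cusp_theorem.

Theorem theorem1p2 (R : realType) :
  (forall (w : R * R) (rho : R), upper_half_plane w -> 0 < rho ->
    exists W : R * R -> R,
      [/\ smooth_on (hdisc w rho) W,
          (forall z, hdisc w rho z -> 0 < W z) &
          forall (lambda : R) (psi : R * R -> R[i]),
            0 < lambda -> eigenfunction lambda psi ->
            hL2 (hdisc w rho) psi ->
            (hboundary_integral (hcircle_param w rho) (2 * pi)%R lambda psi >=
             harea_integral (hdisc w rho)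
               (fun z => W z * cosqnorm (psi z))%R)%E]) /\
  (forall Y : R, 0 < Y ->
    exists W : R * R -> R,
      [/\ unit_periodic_on (cusp_region Y) W,
          smooth_on (cusp_region Y) W,
          (forall z, cusp_region Y z -> 0 < W z) &
          forall (lambda : R) (psi : R * R -> R[i]),
            0 < lambda -> eigenfunction_cylinder lambda psi ->
            hL2 (cusp_strip Y) psi ->
            (hboundary_integral (horocycle_param Y) 1%R lambda psi >=
             harea_integral (cusp_strip Y)
               (fun z => W z * cosqnorm (psi z))%R)%E]).
Proof.
split=> [w rho Hw rho0|Y Y0].
  exists (fun=> 2 / sinh rho); split.
  - exact: smooth_on_cst.
  - by move=> z _; rewrite divr_gt0// sinh_gt0.
  - by move=> lambda psi lam0 eig _; exact: disc_case.
exists (fun z => 2 * Y * expR (- z.2)); split.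
- by [].
- exact: smooth_on_expRN_snd.
- by move=> z _; rewrite !mulr_gt0// expR_gt0.
- by move=> lambda psi lam0 eig L2; exact: cusp_case.
Qed.
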